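(* The $K$-representation $V_{(m,n,n+m)}$ is irreducible for each (integer) $m\ge M$ and $n\ge N$.
   Context: Let $k$ be a $p$-adic field of characteristic $0$ with residual characteristic $p>2$ and residue field of order $q>3$; $\mathcal R$ its integer ring, $\mathfrak p$ the maximal ideal. $K=\mathrm{GL}(3,\mathcal R)$. Let $\chi_2,\chi_3$ be restrictions to $\mathcal R^\times$ of characters of $k^\times$. The conductor $\mathrm{cond}(\psi)$ is the least $m\ge0$ with $1+\mathfrak p^m\subseteq\ker\psi$, with the convention that $\mathrm{cond}(\psi)=0$ iff $\psi|_{\mathcal R^\times}=\mathbf 1$. Put $M=\mathrm{cond}(\chi_2)$, $N=\mathrm{cond}(\chi_3)$ and assume $0\le M\le N$, $N>0$, and $\mathrm{cond}(\chi_2\chi_3^{-1})=N$. Let $\mathbf m=(M,N,N)$. $\mathtt T=\{\mathbf c=(c_1,c_2,c_3)\in\mathbb Z^3:0\le c_1,c_2\le c_3\le c_1+c_2\}$, partially ordered componentwise; $\mathtt T_{\mathbf m}=\{\mathbf c\in\mathtt T:\mathbf c\succeq\mathbf m\}$. $C_{\mathbf c}$ is the subgroup of $g=(g_{ij})\in K$ with $g_{21}\in\mathfrak p^{c_1}$, $g_{32}\in\mathfrak p^{c_2}$, $g_{31}\in\mathfrak p^{c_3}$. For $\mathbf c\in\mathtt T_{\mathbf m}$, $\chi_{\mathbf c}(g)=\chi_2(g_{22})\chi_3(g_{33})$ is a character of $C_{\mathbf c}$ (the factor $\chi_2(g_{22})$ is read as $1$ if $M=0$), and $U_{\mathbf c}=\mathrm{Ind}_{C_{\mathbf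 c}}^K\chi_{\mathbf c}$. All $U_{\mathbf c}$ are regarded as subrepresentations of $\mathrm{Ind}_B^K\chi$, where $B$ is the upper triangular subgroup of $K$ and $\chi$ is the character of $B$ given by $b\mapsto\chi_2(b_{22})\chi_3(b_{33})$; then $U_{\mathbf d}\subseteq U_{\mathbf c}$ when $\mathbf d\preceq\mathbf c$. Set $V_{\mathbf c}=U_{\mathbf c}\big/\sum_{\mathbf d\in\mathtt T_{\mathbf m},\,\mathbf d\prec\mathbf c}U_{\mathbf d}$. *)

(* Defs.v *)
From HB Require Import structures.
From mathcomp Require Import all_boot all_order all_algebra.
From mathcomp Require Import boolp classical_sets functions cardinality reals.
From mathcomp Require Import complex.

Set Implicit Arguments.
Unset Strict Implicit.
Unset Printing Implicit Defensive.

Import Order.TTheory GRing.Theory Num.Theory.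

Local Open Scope ring_scope.
Local Open Scope quotient_scope.

(* The group of units of a (possibly infinite) ring.  It is used below for
   k^x, O^x, C^x and for GL(3, O), the units of 'M[O]_3. *)
Record units (R : unitRingType) :=
  Units { units_val :> R; units_valP : units_val \is a GRing.unit }.

HB.instance Definition _ (R : unitRingType) := [isSub of units R for @units_val R].
HB.instance Definition _ (R : unitRingType) := [Choice of units R by <:].

Section UnitsGroup.
Variable R : unitRingType.
Implicit Types u v : units R.

Definition units_one : units R := Units (unitr1 R).
Definition units_inv u : units R := Units (etrans (unitrV u) (units_valP u)).
Fact units_mul_subproof u v : units_val u * units_val v \is a GRing.unit.
Proof. by rewrite unitrMl ?units_valP. Qed.
Definition units_mul u v : units R := Units (units_mul_subproof u v).

Fact units_mulA : associative units_mul.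
Proof. by move=> u v w; apply/val_inj; rewrite /= mulrA. Qed.
Fact units_mul1 : left_id units_one units_mul.
Proof. by move=> u; apply/val_inj; rewrite /= mul1r. Qed.
Fact units_1mul : right_id units_one units_mul.
Proof. by move=> u; apply/val_inj; rewrite /= mulr1. Qed.
Fact units_mulV : left_inverse units_one units_inv units_mul.
Proof. by move=> u; apply/val_inj; rewrite /= mulVr ?units_valP. Qed.
Fact units_Vmul : right_inverse units_one units_inv units_mul.
Proof. by move=> u; apply/val_inj; rewrite /= mulrV ?units_valP. Qed.

HB.instance Definition _ := isGroup.Build (units R)
  units_mulA units_mul1 units_1mul units_mulV units_Vmul.
End UnitsGroup.

(* Fields with a normalized discrete valuation; the value of [dval] at 0 is
   irrelevant. *)
HB.mixin Record Field_isDiscretelyValued k of GRing.Field k := {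
  dval : k -> int;
  dvalM_subproof : forall x y : k, x != 0 -> y != 0 -> dval (x * y) = dval x + dval y;
  dvalD_subproof : forall x y : k, x != 0 -> y != 0 -> x + y != 0 ->
    Num.min (dval x) (dval y) <= dval (x + y);
  dval_surj_subproof : exists2 x : k, x != 0 & dval x = 1
}.

#[short(type="dvFieldType")]
HB.structure Definition DiscretelyValuedField :=
  {k of Field_isDiscretelyValued k & GRing.Field k}.

Section IntegerRing.
Variable k : dvFieldType.
Implicit Types x y : k.

Lemma dvalM x y : x != 0 -> y != 0 -> dval (x * y) = dval x + dval y.
Proof. exact: dvalM_subproof. Qed.

Lemma dvalD x y : x != 0 -> y != 0 -> x + y != 0 ->
  Num.min (dval x) (dval y) <= dval (x + y).
Proof. exact: dvalD_subproof. Qed.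

Lemma dval_surj : exists2 x : k, x != 0 & dval x = 1.
Proof. exact: dval_surj_subproof. Qed.

(* The fractional ideal p^n. *)
Definition ppow (n : int) : {pred k} := fun x => (x == 0) || (n <= dval x).

Lemma dval1 : @dval k 1 = 0.
Proof.
have := dvalM (oner_neq0 k) (oner_neq0 k); rewrite mulr1 => /eqP.
by rewrite -subr_eq0 opprD addrA subrr sub0r oppr_eq0 => /eqP.
Qed.

Lemma dvalN x : x != 0 -> dval (- x) = dval x.
Proof.
move=> x0; have N0 : (-1 : k) != 0 by rewrite oppr_eq0 oner_neq0.
have : dval (-1 : k) + dval (-1 : k) = 0 by rewrite -dvalM // mulrNN mulr1 dval1.
rewrite -mulr2n => /eqP; rewrite mulrn_eq0 /= => /eqP N1.
by rewrite -mulN1r dvalM // N1 add0r.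
Qed.

Lemma dvalV x : x != 0 -> dval x^-1 = - dval x.
Proof.
move=> x0; have xV0 : x^-1 != 0 by rewrite invr_eq0.
by apply/eqP; rewrite -addr_eq0 -dvalM // mulVf // dval1.
Qed.

Lemma ppow0 n : 0 \in ppow n.
Proof. by rewrite unfold_in eqxx. Qed.

Lemma ppowN n x : x \in ppow n -> - x \in ppow n.
Proof. by rewrite !unfold_in oppr_eq0; case: eqP => //= /eqP x0; rewrite dvalN. Qed.

Lemma ppowD n x y : x \in ppow n -> y \in ppow n -> x + y \in ppow n.
Proof.
rewrite !unfold_in; case: (eqVneq x 0) => [->|x0] /=; first by rewrite add0r.
case: (eqVneq y 0) => [->|y0] /=; first by rewrite addr0 (negPf x0).
move=> nx ny; case: eqVneq => //= xy0.
by apply: le_trans (dvalD x0 y0 xy0); rewrite le_min nx.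
Qed.

Lemma ppowM m n x y : x \in ppow m -> y \in ppow n -> x * y \in ppow (m + n).
Proof.
rewrite !unfold_in mulf_eq0; case: (eqVneq x 0) => //= x0.
by case: (eqVneq y 0) => //= y0 mx ny; rewrite dvalM // lerD.
Qed.

Fact ppow_subring : subring_closed (ppow 0).
Proof.
split=> [|x y xO yO|x y xO yO]; first by rewrite unfold_in dval1 lexx orbT.
  by rewrite ppowD ?ppowN.
by rewrite -[0]addr0 ppowM.
Qed.

HB.instance Definition _ := GRing.isSubringClosed.Build k (ppow 0) ppow_subring.

Record integers := Integer { int_val :> k; int_valP : int_val \in ppow 0 }.

HB.instance Definition _ := [isSub of integers for int_val].
HB.instance Definition _ := [Choice of integers by <:].
HB.instance Definition _ := [SubChoice_isSubComNzRing of integers by <:].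

Definition int_unit : {pred integers} :=
  fun x : integers => (int_val x != 0) && ((int_val x)^-1 \in ppow 0).
Definition int_inv (x : integers) : integers :=
  if x \in int_unit then insubd x (int_val x)^-1 else x.

Fact int_mulVx : {in int_unit, left_inverse 1 int_inv (@GRing.mul integers)}.
Proof.
move=> x xU; apply: val_inj; rewrite /int_inv xU /= insubdK.
  by rewrite mulVf //; case/andP: xU.
by case/andP: xU.
Qed.
Fact int_unitP (x y : integers) : y * x = 1 -> x \in int_unit.
Proof.
move/(congr1 val) => /= yx1; have x0 : (int_val x) != 0.
  by apply/eqP => x0; move/eqP: yx1; rewrite x0 mulr0 eq_sym oner_eq0.
rewrite unfold_in x0 /=; have -> : (int_val x)^-1 = int_val y; last exact: int_valP.
by apply: (mulIf x0); rewrite mulVf.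
Qed.
Fact int_invN : {in [predC int_unit], int_inv =1 id}.
Proof. by move=> x; rewrite inE /int_inv => /negPf ->. Qed.

HB.instance Definition _ :=
  GRing.ComNzRing_hasMulInverse.Build integers int_mulVx int_unitP int_invN.

Fact int_idomain : GRing.integral_domain_axiom integers.
Proof.
move=> x y /(congr1 val) /eqP /=; rewrite mulf_eq0.
by rewrite -!(inj_eq val_inj).
Qed.
HB.instance Definition _ :=
  GRing.ComUnitRing_isIntegral.Build integers int_idomain.

Definition max_ideal : {pred integers} := fun x : integers => int_val x \in ppow 1.

Fact max_idealr : idealr_closed max_ideal.
Proof.
split=> [||a x y xp yp]; rewrite unfold_in /=; first exact: ppow0.
  by rewrite unfold_in oner_eq0 dval1.
by rewrite ppowD // -[1]add0r ppowM ?int_valP.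
Qed.
HB.instance Definition _ := isIdealr.Build integers max_ideal max_idealr.

Definition residue := {ideal_quot max_ideal}.
HB.instance Definition _ := GRing.ComNzRing.on residue.

End IntegerRing.
Arguments ppow {k} n.

(* p-adic fields of characteristic 0 : complete discretely valued fields of
   characteristic 0 whose residue field is finite, of characteristic p and
   order q. *)
Record padic_field (k : dvFieldType) (p q : nat) : Prop := {
  padic_char : [pchar k] =i pred0;
  padic_complete : forall u : nat -> k,
    (forall e : int, exists i0 : nat, forall i j : nat,
       (i0 <= i)%N -> (i0 <= j)%N -> u i - u j \in ppow e) ->
    exists l : k, forall e : int, exists i0 : nat, forall i : nat,
       (i0 <= i)%N -> u i - l \in ppow e;
  padic_residue_char : p \in [pchar (residue k)];
  padic_residue_card : ([set: residue k] #= `I_q)%card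
}.

Section Representations.
Variables (G : groupType) (F : fieldType).

Record representation (V : lmodType F) := Representation {
  rep_act :> G -> V -> V;
  rep_linear : forall g, linear (rep_act g);
  rep1 : forall x, rep_act 1%g x = x;
  repM : forall g h x, rep_act (g * h)%g x = rep_act g (rep_act h x)
}.

Definition stable (V : lmodType F) (rho : representation V) (W : {pred V}) :=
  forall g, {in W, forall x, rho g x \in W}.

Definition irreducible (V : lmodType F) (rho : representation V) : Prop :=
  (exists x : V, x != 0) /\
  forall W : {pred V}, submod_closed W -> stable rho W ->
    (forall x, x \in W -> x = 0) \/ (forall x, x \in W).

Section Quotient.
Variables (V : lmodType F) (W : submodClosed V).

(* W, seen as a mere additive subgroup of V *)
Definition mod_pred : {pred V} := W.
Fact mod_pred_zmod : zmod_closed mod_pred.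
Proof. exact: submodClosedP W. Qed.
HB.instance Definition _ := GRing.isZmodClosed.Build V mod_pred mod_pred_zmod.

Definition quotmod := {ideal_quot mod_pred}.
HB.instance Definition _ := GRing.Zmodule.on quotmod.
HB.instance Definition _ := EqQuotient.on quotmod.

Definition quotmod_pi (x : V) : quotmod := \pi_{ideal_quot mod_pred} x.
Definition quotmod_repr (x : quotmod) : V := repr (x : {ideal_quot mod_pred}).

Lemma quotmod_reprK x : quotmod_pi (quotmod_repr x) = x.
Proof. exact: reprK. Qed.

Lemma quotmod_piE x y : (quotmod_pi x = quotmod_pi y) <-> (x - y \in W).
Proof.
have E : (x - y \in W) = (x == y %[mod {ideal_quot mod_pred}]).
  exact: (Quotient.idealrBE mod_pred).
by rewrite E; split => [xy|/eqP //]; apply/eqP.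
Qed.

Lemma quotmod_piD x y : quotmod_pi (x + y) = quotmod_pi x + quotmod_pi y.
Proof. exact: (raddfD \pi_{ideal_quot mod_pred}). Qed.

Definition quotmod_scale (a : F) (x : quotmod) : quotmod :=
  quotmod_pi (a *: quotmod_repr x).

Lemma quotmod_piZ a x : quotmod_pi (a *: x) = quotmod_scale a (quotmod_pi x).
Proof.
apply/quotmod_piE; rewrite -scalerBr rpredZ //.
by apply/quotmod_piE; rewrite quotmod_reprK.
Qed.

Fact quotmod_scaleA a b x :
  quotmod_scale a (quotmod_scale b x) = quotmod_scale (a * b) x.
Proof. by rewrite -[x]quotmod_reprK -!quotmod_piZ scalerA. Qed.
Fact quotmod_scale1 : left_id 1 quotmod_scale.
Proof. by move=> x; rewrite -[x]quotmod_reprK -quotmod_piZ scale1r. Qed.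
Fact quotmod_scaleDr : right_distributive quotmod_scale +%R.
Proof.
move=> a x y; rewrite -[x]quotmod_reprK -[y]quotmod_reprK.
by rewrite -quotmod_piD -!quotmod_piZ scalerDr quotmod_piD.
Qed.
Fact quotmod_scaleDl x : {morph quotmod_scale^~ x : a b / a + b}.
Proof.
by move=> a b; rewrite -[x]quotmod_reprK -!quotmod_piZ scalerDl quotmod_piD.
Qed.
HB.instance Definition _ := GRing.Zmodule_isLmodule.Build F quotmod
  quotmod_scaleA quotmod_scale1 quotmod_scaleDr quotmod_scaleDl.

Variables (rho : representation V) (Wst : stable rho W).

Definition quot_act (g : G) (x : quotmod) : quotmod :=
  quotmod_pi (rho g (quotmod_repr x)).

Lemma rep_actB g x y : rho g (x - y) = rho g x - rho g y.
Proof.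
by have := rep_linear rho g (-1) y x; rewrite !scaleN1r ![- _ + _]addrC.
Qed.

Lemma quot_actE g x : quot_act g (quotmod_pi x) = quotmod_pi (rho g x).
Proof.
apply/quotmod_piE; rewrite -rep_actB; apply: Wst.
by apply/quotmod_piE; rewrite quotmod_reprK.
Qed.

Fact quot_act_linear g : linear (quot_act g).
Proof.
move=> a x y; rewrite -[x]quotmod_reprK -[y]quotmod_reprK.
have piZ b z : b *: quotmod_pi z = quotmod_pi (b *: z) by rewrite quotmod_piZ.
by rewrite piZ -quotmod_piD !quot_actE rep_linear quotmod_piD piZ.
Qed.
Fact quot_act1 x : quot_act 1%g x = x.
Proof. by rewrite -[x]quotmod_reprK quot_actE rep1. Qed.
Fact quot_actM g h x : quot_act (g * h)%g x = quot_act g (quot_act h x).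
Proof. by rewrite -[x]quotmod_reprK !quot_actE repM. Qed.

Definition quot_rep : representation quotmod :=
  Representation quot_act_linear quot_act1 quot_actM.

End Quotient.
End Representations.

Section PrincipalSeries.
Variables (R : realType) (k : dvFieldType).
Local Notation C := R[i].
Local Notation O := (integers k).

Definition GL3 := units 'M[O]_3.
HB.instance Definition _ := Group.on GL3.
Local Notation K := GL3.

Definition entry (g : K) (i j : 'I_3) : O := (units_val g : 'M[O]_3) i j.

Definition char_continuous (X : units k -> units C) : Prop :=
  forall (x : units k) (eps : R), 0 < eps ->
    exists e : int, forall y : units k,
      units_val y - units_val x \in ppow e ->
      `|units_val (X y) - units_val (X x)| < eps%:C%C.

Fact unit_incl_subproof (u : units O) : int_val (units_val u) \is a GRing.unit.
Proof. by rewrite unitfE; case/andP: (units_valP u). Qed.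
Definition unit_incl (u : units O) : units k := Units (unit_incl_subproof u).

Definition res_units (X : units k -> units C) : units O -> units C :=
  X \o unit_incl.

(* For m = 0 the condition on u is void, so that conductor 0 means trivial on
   O^x. *)
Definition trivial_at (psi : units O -> units C) (m : nat) : Prop :=
  forall u : units O, int_val (units_val u) - 1 \in ppow m%:Z -> psi u = 1%g.

Definition is_cond (psi : units O -> units C) (m : nat) : Prop :=
  trivial_at psi m /\ forall m', trivial_at psi m' -> (m <= m')%N.

Definition congr_subgroup (n : nat) : set K :=
  [set g | forall i j, int_val (entry g i j) - (i == j)%:R \in ppow n%:Z].

(* Smooth induction from H to K of the character psi of H (only the values of
   psi on H matter), as a space of functions on K on which K acts by right
   translation. *)
Definition ind_pred (H : set K) (psi : K -> C) : {pred K -> C^o} :=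
  fun f => `[< (forall h g : K, H h -> f (h * g)%g = psi h * f g) /\
               exists n : nat, forall g h : K,
                 congr_subgroup n h -> f (g * h)%g = f g >].

Lemma congr_subgroup_le m n : (m <= n)%N ->
  (congr_subgroup n `<=` congr_subgroup m)%classic.
Proof.
move=> mn g gn i j; have := gn i j; rewrite !unfold_in => /orP[->//|h].
by rewrite (le_trans _ h) ?orbT // lez_nat.
Qed.

Fact ind_submod H psi : submod_closed (ind_pred H psi).
Proof.
split.
  by rewrite unfold_in; apply/asboolP; split=> [h g _|]; [rewrite /= mulr0|exists 0%N].
move=> a f1 f2; rewrite !unfold_in => /asboolP[e1 [n1 s1]] /asboolP[e2 [n2 s2]].
apply/asboolP; split=> [h g Hh|].
  by rewrite !fctE e1 // e2 // mulrDr !/(_ *: _) /= mulrCA.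
exists (maxn n1 n2) => g h hn; rewrite !fctE s1 ?s2 //.
  exact: congr_subgroup_le (leq_maxr n1 n2) _ hn.
exact: congr_subgroup_le (leq_maxl n1 n2) _ hn.
Qed.
HB.instance Definition _ H psi :=
  GRing.isSubmodClosed.Build C (K -> C^o) (ind_pred H psi) (ind_submod H psi).

Record Ind (H : set K) (psi : K -> C) :=
  MkInd { ind_fun :> K -> C^o; ind_funP : ind_fun \in ind_pred H psi }.
HB.instance Definition _ H psi := [isSub of Ind H psi for @ind_fun H psi].
HB.instance Definition _ H psi := [Choice of Ind H psi by <:].
HB.instance Definition _ H psi := [SubChoice_isSubLmodule of Ind H psi by <:].

Lemma congr_subgroupJ n (x h : K) :
  congr_subgroup n h -> congr_subgroup n (x^-1 * h * x)%g.
Proof.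
pose small (A : 'M[O]_3) := forall i j, int_val (A i j) \in ppow n%:Z.
have smallE (g : K) : congr_subgroup n g <-> small (units_val g - 1).
  have E i j : int_val (entry g i j) - (i == j)%:R
             = int_val ((units_val g - 1 : 'M[O]_3) i j).
    by rewrite !mxE; case: (i == j).
  by split=> gn i j; [rewrite -E|rewrite E].
have sumP (F : 'I_3 -> O) :
    (forall i, int_val (F i) \in ppow n%:Z) -> int_val (\sum_i F i) \in ppow n%:Z.
  move=> Fn; elim/big_ind: _ => [|a b an bn|i _] //; first exact: ppow0.
  exact: ppowD.
have mulP (a b : O) : int_val a \in ppow n%:Z -> int_val (a * b) \in ppow n%:Z.
  by move=> an; rewrite -[n%:Z]addr0; apply: ppowM an (int_valP b).
have smallM (A B : 'M[O]_3) : small A -> small (A *m B) /\ small (B *m A).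
  move=> An; split=> i j; rewrite mxE; apply: sumP => l; first exact: mulP.
  by rewrite mulrC; apply: mulP.
move=> /smallE hn; apply/smallE.
have -> : units_val (x^-1 * h * x)%g - 1
    = (units_val x^-1%g *m (units_val h - 1)) *m units_val x :> 'M[O]_3.
  rewrite mulmxBr mulmxBl mulmx1; congr (_ - _).
  by rewrite -[LHS](mulVr (units_valP x)).
by apply: (proj1 (smallM _ _ _)); apply: (proj2 (smallM _ _ _)).
Qed.

Section RightTranslation.
Variables (H : set K) (psi : K -> C).

Fact rtrans_subproof (x : K) (f : Ind H psi) :
  ((fun g => f (g * x)%g) : K -> C^o) \in ind_pred H psi.
Proof.
have := ind_funP f; rewrite !unfold_in => /asboolP[e [n s]].
apply/asboolP; split=> [h g Hh|].
  by rewrite -mulgA; apply: e.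
exists n => g h hn.
have -> : (g * h * x = (g * x) * (x^-1 * h * x))%g by rewrite !mulgA mulgK.
by rewrite s //; apply: congr_subgroupJ.
Qed.

Definition rtrans (x : K) (f : Ind H psi) : Ind H psi :=
  MkInd (rtrans_subproof x f).

Fact rtrans_linear x : linear (rtrans x).
Proof. by move=> a f1 f2; apply: val_inj; apply/funext => g. Qed.
Fact rtrans1 f : rtrans 1%g f = f.
Proof. by apply: val_inj; apply/funext => g /=; rewrite mulg1. Qed.
Fact rtransM x y f : rtrans (x * y)%g f = rtrans x (rtrans y f).
Proof. by apply: val_inj; apply/funext => g /=; rewrite mulgA. Qed.

Definition ind_rep : representation K (Ind H psi) :=
  Representation rtrans_linear rtrans1 rtransM.
End RightTranslation.

Definition triple := (int * int * int)%type.

Definition triple_le (d c : triple) : bool :=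
  let: (d1, d2, d3) := d in let: (c1, c2, c3) := c in
  [&& d1 <= c1, d2 <= c2 & d3 <= c3].
Definition triple_lt (d c : triple) : bool := triple_le d c && (d != c).

Definition inT (c : triple) : bool :=
  let: (c1, c2, c3) := c in
  [&& 0 <= c1, 0 <= c2, c1 <= c3, c2 <= c3 & c3 <= c1 + c2].
Definition inTm (m c : triple) : bool := inT c && triple_le m c.

(* Matrix indices start at 0. *)
Definition C_ (c : triple) : set K :=
  let: (c1, c2, c3) := c in
  [set g | [/\ int_val (entry g 1 0) \in ppow c1,
               int_val (entry g 2 1) \in ppow c2 &
               int_val (entry g 2 0) \in ppow c3]].

(* A character of O^x as a function on O.  Its value 1 outside O^x plays no
   role: it is only evaluated at diagonal entries which are units. *)
Definition ev (psi : units O -> units C) (x : O) : C :=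
  if insub x is Some u then units_val (psi u) else 1.

Section Quotients.
(* [M] and [N] are to be the conductors of [chi2] and [chi3]. *)
Variables (chi2 chi3 : units O -> units C) (M N : nat).

Definition chi_ (g : K) : C :=
  (if M == 0%N then 1 else ev chi2 (entry g 1 1)) * ev chi3 (entry g 2 2).

Definition U_ (c : triple) := Ind (C_ c) chi_.

Definition Borel : set K :=
  [set b | [/\ entry b 1 0 = 0, entry b 2 0 = 0 & entry b 2 1 = 0]].
Definition chi_B (b : K) : C := ev chi2 (entry b 1 1) * ev chi3 (entry b 2 2).

(* All the U_c are spaces of functions on K, contained in Ind_B^K chi, so that
   their inclusions, sums and the quotients below are those of functions. *)
Lemma U_subset_IndB c : is_cond chi2 M ->
  {subset ind_pred (C_ c) chi_ <= ind_pred Borel chi_B}.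
Proof.
move=> [M2 _] f; rewrite !unfold_in => /asboolP[e s].
apply/asboolP; split=> // h g [h1 h2 h3].
have Ch : C_ c h.
  by case: c {e} => [[c1 c2] c3]; split; rewrite ?(h1, h2, h3); apply: ppow0.
rewrite e //; congr (_ * _); rewrite /chi_ /chi_B.
case: eqP => // M0; congr (_ * _); rewrite /ev.
case: insubP => // u _ _; rewrite M2 // M0.
by apply: ppowD; [exact: int_valP|apply: ppowN; exact: int_valP (1 : O)].
Qed.

Lemma U_subset d c : triple_le d c ->
  {subset ind_pred (C_ d) chi_ <= ind_pred (C_ c) chi_}.
Proof.
case: d c => [[d1 d2] d3] [[c1 c2] c3] /and3P[l1 l2 l3] f.
have le_ppow (a b : int) x : a <= b -> x \in @ppow k b -> x \in ppow a.
  by move=> ab; rewrite !unfold_in => /orP[->//|/(le_trans ab)->]; rewrite orbT.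
rewrite !unfold_in => /asboolP[e s]; apply/asboolP; split=> // h g [h1 h2 h3].
apply: e; split.
- exact: le_ppow l1 h1.
- exact: le_ppow l2 h2.
- exact: le_ppow l3 h3.
Qed.

(* The sum of the U_d over d in T_m, d < c, where m = (M, N, N). *)
Definition lower (c : triple) : {pred U_ c} := fun f =>
  `[< exists2 s : seq (K -> C^o),
        forall h, h \in s -> exists d : triple,
          [/\ inTm (M%:Z, N%:Z, N%:Z) d, triple_lt d c &
              h \in ind_pred (C_ d) chi_]
      & ind_fun f = \sum_(h <- s) h >].

Fact lower_submod c : submod_closed (@lower c).
Proof.
split.
  by rewrite unfold_in; apply/asboolP; exists [::]; rewrite ?big_nil.
move=> a f1 f2; rewrite !unfold_in => /asboolP[s1 h1 e1] /asboolP[s2 h2 e2].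
apply/asboolP; exists ([seq a *: h | h <- s1] ++ s2).
  move=> h; rewrite mem_cat => /orP[/mapP[h' /h1[d [dT dc dU]] ->]|/h2//].
  by exists d; split=> //; apply: rpredZ.
by rewrite big_cat big_map /= -scaler_sumr -e1 -e2.
Qed.
HB.instance Definition _ c :=
  GRing.isSubmodClosed.Build C (U_ c) (@lower c) (lower_submod c).

Fact lower_stable c : stable (ind_rep (C_ c) chi_) (@lower c).
Proof.
move=> x f; rewrite !unfold_in => /asboolP[s hs e].
apply/asboolP; exists [seq (fun g => h (g * x)%g) : K -> C^o | h <- s].
  move=> _ /mapP[h /hs[d [dT dc dU]] ->]; exists d; split=> //.
  exact: (rtrans_subproof x (MkInd dU)).
rewrite big_map /= e fct_sumE; apply/funext => g.
by rewrite fct_sumE.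
Qed.

Definition V_ (c : triple) := quotmod (@lower c).
Definition V_rep (c : triple) : representation K (V_ c) :=
  quot_rep (@lower_stable c).

End Quotients.
End PrincipalSeries.

(* Main.v *)
Require Import Defs.
From HB Require Import structures.
From mathcomp Require Import all_boot all_order all_algebra.
From mathcomp Require Import boolp classical_sets functions cardinality reals.
From mathcomp Require Import complex ring zify.

Set Implicit Arguments.
Unset Strict Implicit.
Unset Printing Implicit Defensive.

Import Order.TTheory GRing.Theory Num.Theory.
Local Open Scope ring_scope.

(** Write c = (m, n, m + n), O for the ring of integers, and p for its maximal
ideal; matrix indices start at 0.  Put a = m + n - 1.

Suppose first that m > 0.  The indices of T_m below c have a greatest element
d = (m, n, a), so V_c = U_c / U_d.  Now C_d / C_c is represented by the matrices
1 + y E_20 with y in p^a / p^(a+1), a copy of the residue field, and the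
representation of C_d induced from chi on C_c splits into chi and a rest, which
involves every nontrivial additive character of p^a / p^(a+1) once.  The torus
permutes these transitively, so the rest is induced from the stabilizer H of one of
them, theta, and V_c is induced to K from the character
psi (h) = chi (h) theta (h20 / h22) of
H = {h in C_(m, n, a) : h00 = h22 modulo p}.
This is made concrete by the functional l that takes the Fourier coefficient at
theta of y |-> f (1 + y E_20): it is (H, psi)-equivariant ([functional_col0_equiv]),
and the common kernel of its translates is U_d ([kernel_col0]).

By Mackey's criterion ([mackey_irreducible]) it remains to see that no g outside H
intertwines psi with itself ([stab_no_intertwiner]).  Testing against elements of
1 + p^a M_3(O) shows that g commutes with E_02 modulo p, hence g is upper triangular
modulo p with g00 = g22.  After clearing the last column of g inside H g, the
elements 1 + t E_21, 1 + t E_10 and 1 + t E_00 force the lower entries of g into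
p^m, p^n and p^a in turn: at each step t can be chosen so that, if the entry
were too large, the conjugate of the test element stays in H but is moved by theta.

If m = 0, then M = 0 and chi is the character chi3 (g22).  For n > N the greatest
index below c is (0, n - 1, n - 1), and the cosets of C_c are represented by a plane
1 + y E_20 + z E_21 over the residue field, on whose characters GL_2 acts
transitively.  The stabilizer of (y, z) |-> theta (y) is the group H attached to the
pair (1, n - 1), with the same psi, so the same intertwining computation finishes the
proof.  For n = N there is no index below c, V_c is induced from chi on C_c, and
chi is not intertwined outside C_c because N is exactly the conductor of chi3
([conductor_no_intertwiner]). *)

(** * Mackey's criterion for a quotient *)

Section Mackey.
Variables (G : groupType) (F : fieldType) (V : lmodType F).
Variables (rho : representation G V) (L : submodClosed V) (Lst : stable rho L).
Variables (H : set G) (psi : G -> F) (l : V -> F).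
Hypothesis charF : [pchar F] =i pred0.
Hypothesis l_lin : scalar l.
Hypothesis H1 : H 1%g.
Hypothesis HM : forall g h, H g -> H h -> H (g * h)%g.
Hypothesis l_equiv : forall h v, H h -> l (rho h v) = psi h * l v.
Hypothesis l_ker : forall v, (forall g, l (rho g v) = 0) <-> v \in L.
Hypothesis proper : exists v, v \notin L.
Hypothesis orbit_fin : forall v, exists s : seq V, forall g, rho g v \in s.
Hypothesis cosets_fin :
  exists s : seq G, forall g, exists2 k, k \in s & exists2 h, H h & g = (h * k)%g.
Hypothesis no_intertw : forall g, ~ H g -> exists b h h',
  [/\ H b, H h, H h', (b * g * h = h' * (b * g))%g & psi h != psi h'].

Local Lemma repD g u v : rho g (u + v) = rho g u + rho g v.
Proof. by have := rep_linear rho g 1 u v; rewrite !scale1r. Qed.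
Local Lemma rep0 g : rho g 0 = 0.
Proof. by apply: (addrI (rho g 0)); rewrite -repD !addr0. Qed.
Local Lemma repZ g a v : rho g (a *: v) = a *: rho g v.
Proof. by have := rep_linear rho g a v 0; rewrite !addr0 rep0 addr0. Qed.
Local Lemma l0 : l 0 = 0.
Proof. by have := l_lin (-1) 0 0; rewrite scaler0 addr0 mulN1r addNr. Qed.
Local Lemma lD u v : l (u + v) = l u + l v.
Proof. by have := l_lin 1 u v; rewrite scale1r mul1r. Qed.
Local Lemma lZ a v : l (a *: v) = a * l v.
Proof. by have := l_lin a v 0; rewrite !addr0 l0 addr0. Qed.
Local Lemma rep_inj g : injective (rho g).
Proof.
by move=> u v /(congr1 (rho g^-1%g)); rewrite -!repM mulVg !rep1.
Qed.

Local Lemma l_witness v : v \notin L -> exists g, l (rho g v) != 0.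
Proof.
move=> vL; apply: contrapT => no; move/negP: vL; apply; apply/l_ker => g.
by apply: contrapT => /eqP lg; apply: no; exists g.
Qed.

Local Lemma psi_neq0 h : H h -> psi h != 0.
Proof.
move=> Hh; have [v /l_witness[g lg]] := proper.
apply: contraNneq lg => p0.
by rewrite -[rho g v](rep1 rho) -(mulgV h) repM l_equiv // p0 mul0r.
Qed.

Local Lemma psiM g h : H g -> H h -> psi (g * h)%g = psi g * psi h.
Proof.
move=> Hg Hh; have [v /l_witness[x lx]] := proper; apply: (mulIf lx).
have Hgh := HM Hg Hh.
by rewrite -(l_equiv _ Hgh) repM (l_equiv _ Hg) (l_equiv _ Hh) mulrA.
Qed.

Section Closed.
Variable W : {pred V}.
Hypothesis Wsub : submod_closed W.
Hypothesis Wst : stable rho W.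
Hypothesis LW : {subset L <= W}.

Local Lemma W_lin a u v : u \in W -> v \in W -> a *: u + v \in W.
Proof. by move=> uW vW; apply: (proj2 Wsub). Qed.
Local Lemma WZ a u : u \in W -> a *: u \in W.
Proof. by move=> uW; rewrite -[_ *: _]addr0 W_lin //; case: Wsub. Qed.

(** Projecting onto the psi-eigenspace of H would normally average over a
    finite quotient of H.  The vectors psi(h)^-1 rho(h) v already form a finite
    set, which the twisted action of H permutes, so the sum of the distinct ones
    is an eigenvector; l takes the same value on each of them, so l of the sum
    is a nonzero multiple of l v. *)
Local Lemma averaging v : v \in W -> l v != 0 -> exists v1,
  [/\ v1 \in W, l v1 != 0 & forall h, H h -> rho h v1 = psi h *: v1].
Proof.
move=> vW lv; have [t t_orb] := orbit_fin v.
pose S := undup [seq (l v / l w) *: w | w <- t & `[< exists2 h, H h & w = rho h v >]].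
have Sin h : H h -> (psi h)^-1 *: rho h v \in S.
  move=> Hh; rewrite mem_undup; apply/mapP; exists (rho h v).
    by rewrite mem_filter t_orb andbT; apply/asboolP; exists h.
  by rewrite l_equiv // invfM mulrCA divff // mulr1.
have inS w : w \in S -> exists2 h, H h & w = (psi h)^-1 *: rho h v.
  rewrite mem_undup => /mapP[_ /[!mem_filter] /andP[/asboolP[h Hh ->] _] ->].
  by exists h => //; rewrite l_equiv // invfM mulrCA divff // mulr1.
have lS w : w \in S -> l w = l v.
  by case/inS=> h Hh ->; rewrite lZ l_equiv // mulKf ?psi_neq0.
have sum_ind (P : V -> Prop) (s : seq V) : P 0 ->
    (forall x y, x \in s -> P y -> P (x + y)) -> P (\sum_(w <- s) w).
  elim: s => [|x s IH] P0 PD; first by rewrite big_nil.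
  rewrite big_cons; apply: (PD x); rewrite ?mem_head //; apply: IH => // a b aS.
  by apply: PD; rewrite inE aS orbT.
exists (\sum_(w <- S) w); split.
- apply: (sum_ind (fun x => x \in W)) => [|x y xS yW]; first by case: Wsub.
  rewrite -[x]scale1r W_lin //; case/inS: xS => h Hh ->.
  by apply/WZ/Wst.
- have -> : l (\sum_(w <- S) w) = l v *+ size S.
    elim: (S) lS => [|x s IH] lS'; first by rewrite big_nil l0.
    rewrite big_cons lD IH => [|w ws]; last by rewrite lS' // inE ws orbT.
    by rewrite lS' ?mem_head // mulrS.
  rewrite -mulr_natr mulf_neq0 //.
  have /(pcharf0P F) -> := charF.
  have := Sin _ H1; by case: (S).
- move=> h Hh; rewrite -[LHS]scale1r -(divff (psi_neq0 Hh)) -scalerA; congr (_ *: _).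
  pose tw w := (psi h)^-1 *: rho h w.
  have twD x y : tw (x + y) = tw x + tw y by rewrite /tw repD scalerDr.
  have tw0 : tw 0 = 0 by rewrite /tw rep0 scaler0.
  have -> : (psi h)^-1 *: rho h (\sum_(w <- S) w) = \sum_(w <- map tw S) w.
    rewrite big_map -/(tw _); elim: (S) => [|x s IH]; first by rewrite !big_nil tw0.
    by rewrite !big_cons twD IH.
  have tw_inj : injective tw.
    have pV : (psi h)^-1 != 0 by rewrite invr_eq0 psi_neq0.
    by move=> x y /(scalerI pV) /rep_inj.
  have tw_uniq : uniq (map tw S) by rewrite map_inj_uniq ?undup_uniq.
  have sub : {subset map tw S <= S}.
    move=> _ /mapP[_ /inS[g Hg ->] ->].
    by rewrite /tw repZ scalerA -invfM -psiM // -repM; apply: Sin; apply: HM.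
  have [_ eqS] := uniq_min_size tw_uniq sub (eq_leq (esym (size_map tw S))).
  by apply: perm_big; rewrite perm_sym; apply: uniq_perm; rewrite ?undup_uniq.
Qed.

(** For an eigenvector v1, the function g |-> l (rho g v1) vanishes off H,
    because an intertwining relation at g equates two different multiples of its
    value.  Its translates are therefore supported on single cosets H k, and
    subtracting suitable multiples of them clears the transform of any vector
    coset by coset; what is left has zero transform, so it lies in L. *)
Local Lemma generate v1 : v1 \in W -> l v1 != 0 ->
  (forall h, H h -> rho h v1 = psi h *: v1) -> forall v, v \in W.
Proof.
move=> v1W lv1 eig v.
have supp g : ~ H g -> l (rho g v1) = 0.
  move=> /no_intertw[b [h [h' [Hb Hh Hh' e ne]]]].
  have := congr1 (fun x => l (rho x v1)) e.
  rewrite /= repM eig // repZ lZ [in RHS]repM (l_equiv _ Hh').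
  move/eqP; rewrite -subr_eq0 -mulrBl mulf_eq0 subr_eq0 (negPf ne) /=.
  by rewrite repM l_equiv // mulf_eq0 (negPf (psi_neq0 Hb)) /= => /eqP.
have [s cov] := cosets_fin.
suff gen (t : seq G) v' :
    (forall g, (forall k h, k \in t -> H h -> g <> (h * k)%g) -> l (rho g v') = 0) ->
    v' \in W.
  apply: (gen s) => g none; have [k ks [h Hh e]] := cov g.
  by case: (none k h).
elim: t v' => [|k t IH] u vanish.
  by apply: LW; apply/l_ker => g; apply: vanish.
pose c := l (rho k u) / l v1.
have -> : u = c *: rho k^-1%g v1 + (u - c *: rho k^-1%g v1) by rewrite addrC subrK.
apply: W_lin; first exact: Wst.
(* off H k both terms vanish; on H k they cancel by the choice of c *)
apply: IH => g none.
have -> : l (rho g (u - c *: rho k^-1%g v1)) = l (rho g u) - c * l (rho (g * k^-1)%g v1).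
  by rewrite repD -scaleNr lD repZ lZ mulNr repM.
have [Hgk|nHgk] := pselect (H (g * k^-1)%g).
  have -> : l (rho g u) = psi (g * k^-1)%g * l (rho k u).
    by rewrite -l_equiv // -repM mulgVK.
  by rewrite (l_equiv _ Hgk) /c mulrCA divfK // subrr.
rewrite supp // mulr0 subr0 vanish // => k' h; rewrite inE => /orP[/eqP->|kt] Hh e.
  by apply: nHgk; rewrite e mulgK.
exact: none kt Hh e.
Qed.
End Closed.

(** Mackey's irreducibility criterion for an induced representation that is
    known only through a Frobenius functional: l is the (H, psi)-equivariant
    form whose translates have common kernel L, so that v |-> (g |-> l (rho g v))
    embeds V / L in the representation induced from psi.  A coset H g other
    than H carries no intertwining operator if some x in H g has h, h' in H with
    x h = h' x and psi h <> psi h'. *)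
Theorem mackey_irreducible : irreducible (quot_rep Lst).
Proof.
have pi0 : quotmod_pi L 0 = 0.
  by apply: (addrI (quotmod_pi L 0)); rewrite -quotmod_piD !addr0.
split.
  have [v vL] := proper; exists (quotmod_pi L v).
  by apply: contra vL => /eqP; rewrite -pi0 => /quotmod_piE; rewrite subr0.
move=> W Wsub Wst.
pose W' : {pred V} := fun v => quotmod_pi L v \in W.
have W'sub : submod_closed W'.
  split; first by rewrite unfold_in pi0; case: Wsub.
  move=> a u v uW vW; rewrite unfold_in quotmod_piD quotmod_piZ.
  exact: (proj2 Wsub).
have W'st : stable rho W'.
  by move=> g u uW; rewrite unfold_in -(quot_actE Lst); apply: Wst.
have LW' : {subset L <= W'}.
  move=> v vL; rewrite unfold_in.
  have -> : quotmod_pi L v = 0 by rewrite -pi0; apply/quotmod_piE; rewrite subr0.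
  by case: Wsub.
have [all0|] := pselect (forall v, v \in W' -> v \in L).
  left=> x xW; rewrite -[x]quotmod_reprK -pi0; apply/quotmod_piE; rewrite subr0.
  by apply: all0; rewrite unfold_in quotmod_reprK.
move=> /existsNP[v /not_implyP[vW /negP vL]]; right=> x.
have [g lg] := l_witness vL.
have [v1 [v1W lv1 eig]] := averaging W'sub W'st (W'st g _ vW) lg.
by have := generate W'sub W'st LW' v1W lv1 eig (quotmod_repr x);
  rewrite unfold_in quotmod_reprK.
Qed.
End Mackey.

(** * Powers of the maximal ideal *)

Section Ideals.
Variable k : dvFieldType.
Local Notation O := (integers k).

(** The ideal p^n of the ring of integers; the exponent is a natural number,
    because the representations only involve integral ideals. *)
Definition mpow (n : nat) : {pred O} := fun x => int_val x \in ppow n%:Z.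

Fact mpow_zmod n : zmod_closed (mpow n).
Proof.
split=> [|x y xn yn]; first exact: ppow0.
by apply: ppowD => //; apply: ppowN.
Qed.
HB.instance Definition _ n := GRing.isZmodClosed.Build O (mpow n) (mpow_zmod n).

Lemma mpow_0 n : 0 \in mpow n. Proof. exact: rpred0. Qed.
Lemma mpowD n x y : x \in mpow n -> y \in mpow n -> x + y \in mpow n.
Proof. exact: rpredD. Qed.
Lemma mpowN n x : x \in mpow n -> - x \in mpow n.
Proof. by rewrite rpredN. Qed.

Lemma mpow_le m n x : (m <= n)%N -> x \in mpow n -> x \in mpow m.
Proof.
move=> mn; rewrite !unfold_in => /orP[->//|h].
by rewrite (le_trans _ h) ?orbT // lez_nat.
Qed.

Lemma mpowM m n x y : x \in mpow m -> y \in mpow n -> x * y \in mpow (m + n).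
Proof. by move=> xm yn; rewrite unfold_in PoszD; apply: ppowM. Qed.

Lemma mpowMr n x y : x \in mpow n -> x * y \in mpow n.
Proof. by move=> xn; rewrite -[n]addn0 mpowM //; apply: int_valP. Qed.

Lemma mpowMl n x y : y \in mpow n -> x * y \in mpow n.
Proof. by rewrite mulrC; apply: mpowMr. Qed.

Lemma mpowM_le l m n x y : (l <= m + n)%N ->
  x \in mpow m -> y \in mpow n -> x * y \in mpow l.
Proof. by move=> lmn xm yn; apply: mpow_le lmn (mpowM xm yn). Qed.

Lemma unit_mpow1 x : (x \is a GRing.unit) = (x \notin mpow 1).
Proof.
have := int_valP x; rewrite ![x \in _]unfold_in /= /int_unit /mpow /ppow !unfold_in.
case: (eqVneq (int_val x) 0) => //= x0 h.
by rewrite invr_eq0 (negPf x0) dvalV //=; lia.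
Qed.

Lemma unit_cong n x y : (0 < n)%N -> y - x \in mpow n ->
  x \is a GRing.unit -> y \is a GRing.unit.
Proof.
move=> n0 xy; rewrite !unit_mpow1; apply: contra => y1.
by rewrite -[x](subKr y) rpredB // (mpow_le n0).
Qed.

Lemma unit_mpowMl n u x : u \is a GRing.unit -> (u * x \in mpow n) = (x \in mpow n).
Proof.
move=> uu; apply/idP/idP => [h|]; last exact: mpowMl.
by rewrite -[x](mulKr uu) mpowMl.
Qed.

Lemma unit_mpowMr n u x : u \is a GRing.unit -> (x * u \in mpow n) = (x \in mpow n).
Proof. by rewrite mulrC; apply: unit_mpowMl. Qed.

(** Division with control of the valuations: x has valuation at most a - 1,
    so a multiple of x that lies in p^e is reached by a factor in p^(e + 1 - a).
    This is where the test elements of the intertwining computations come from. *)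
Lemma mpow_div a e x y : x \notin mpow a -> (a <= e.+1)%N -> y \in mpow e ->
  exists2 t, t \in mpow (e.+1 - a) & t * x = y.
Proof.
move=> xa ae ye.
have x0 : int_val x != 0.
  by apply: contraNneq xa => x0; rewrite unfold_in /mpow x0 ppow0.
have tP (b : nat) : (b <= e.+1 - a)%N -> int_val y / int_val x \in ppow b%:Z.
  move: ye xa; rewrite !unfold_in mulf_eq0 invr_eq0 (negPf x0) orbF /=.
  case: (eqVneq (int_val y) 0) => //= y0 ye xa be.
  by rewrite dvalM ?invr_eq0 // dvalV //; lia.
exists (Integer (tP 0%N isT)); first by rewrite unfold_in; apply: tP.
by apply: val_inj; rewrite /= divfK.
Qed.

Lemma mpow_gen a : exists2 w : O, w \in mpow a & forall b, w \in mpow b -> (b <= a)%N.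
Proof.
have [x x0 x1] := dval_surj k.
have dx n : dval (x ^+ n) = n%:Z.
  elim: n => [|n IH]; first by rewrite dval1.
  by rewrite exprS dvalM ?expf_neq0 // IH x1; lia.
have wP : x ^+ a \in ppow 0 by rewrite unfold_in dx orbT.
exists (Integer wP) => [|b]; rewrite !unfold_in /= dx.
  by rewrite lexx orbT.
by rewrite expf_eq0 (negPf x0) andbF.
Qed.

Lemma mpow_proper a : exists2 w : O, w \in mpow a & w \notin mpow a.+1.
Proof.
by have [w wa wn] := mpow_gen a; exists w => //; apply/negP => /wn; rewrite ltnn.
Qed.

End Ideals.
Arguments mpow {k} n.

(** * Matrices over the ring of integers *)

Section Matrices.
Variable k : dvFieldType.
Local Notation O := (integers k).
Local Notation K := (GL3 k).
Implicit Types g h : K.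

Lemma ord3_ind (P : 'I_3 -> Prop) : P 0 -> P 1 -> P 2 -> forall i, P i.
Proof.
move=> P0 P1 P2 [[|[|[|//]]] i3].
- by rewrite (_ : Ordinal i3 = 0) //; apply: val_inj.
- by rewrite (_ : Ordinal i3 = 1) //; apply: val_inj.
- by rewrite (_ : Ordinal i3 = 2) //; apply: val_inj.
Qed.

Lemma sum3 (F : 'I_3 -> O) : \sum_i F i = F 0 + F 1 + F 2.
Proof.
rewrite !big_ord_recl big_ord0 addr0 addrA.
by congr (F _ + F _ + F _); apply: val_inj.
Qed.

Lemma entryM g h i j : entry (g * h)%g i j =
  entry g i 0 * entry h 0 j + entry g i 1 * entry h 1 j + entry g i 2 * entry h 2 j.
Proof. by rewrite /entry /= mxE sum3. Qed.

Lemma entry1 i j : entry (1%g : K) i j = (i == j)%:R.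
Proof. by rewrite /entry /= mxE. Qed.

Lemma entry_inj g h : (forall i j, entry g i j = entry h i j) -> g = h.
Proof. by move=> gh; apply/val_inj/matrixP. Qed.

(** Rank-one perturbations of the identity, 1 + a b with a a column and b a
    row: transvections, dilations and all the test elements below have this form,
    and conjugation by g turns (a, b) into (g a, b g^-1).  By the identity
    (1 + a b)^-1 = 1 - (1 + b a)^-1 a b they are invertible when 1 + b a is a unit. *)
Definition rank1 (a b : 'I_3 -> O) : K :=
  insubd (1%g : K) (1%:M + (\col_i a i) *m (\row_j b j)).

Lemma entry_rank1 (a b : 'I_3 -> O) :
  1 + (b 0 * a 0 + b 1 * a 1 + b 2 * a 2) \is a GRing.unit ->
  forall i j, entry (rank1 a b) i j = (i == j)%:R + a i * b j.
Proof.
set u := 1 + _ => uu i j; rewrite /entry /rank1 val_insubd.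
set A := \col_i a i; set B := \row_j b j.
have BA : B *m A = (u - 1)%:M.
  by apply/matrixP => i' j'; rewrite !ord1 !mxE sum3 !mxE /u eqxx mulr1n [1 + _]addrC addrK.
suff -> : 1%:M + A *m B \is a GRing.unit.
  by rewrite !mxE big_ord1 !mxE.
have E : (1%:M + A *m B) *m (1%:M - u^-1 *: (A *m B)) = 1%:M.
  rewrite mulmxBr mulmx1 mulmxDl mul1mx -scalemxAr -mulmxA [B *m _]mulmxA BA.
  rewrite mul_scalar_mx -scalemxAr scalerA -addrA; apply/eqP; rewrite -subr_eq0 addrAC subrr add0r.
  rewrite opprD -!scaleNr -{1}[A *m B]scale1r -!scalerDl.
  rewrite (_ : _ + _ = 0) ?scale0r //.
  by rewrite mulrBr mulVr // mulr1; ring.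
by have [] := mulmx1_unit E.
Qed.

End Matrices.

(** * The congruence subgroups *)

(** The inequalities between exponents follow from the inequalities in the
    context alone; clearing the rest keeps the preprocessing of [lia] short. *)
Ltac nat_solve :=
  repeat match goal with H : ?T |- _ =>
    lazymatch T with
    | nat => fail | is_true (leq _ _) => fail | @eq nat _ _ => fail | _ => clear H
    end
  end; lia.

(** Membership in a power of the maximal ideal, read off from the shape of a
    polynomial expression and the memberships in the context. *)
Ltac mpow_solve :=
  lazymatch goal with
  | h : ?T |- ?T => exact: h
  | |- is_true (0 \in _) => exact: mpow_0
  | |- is_true (_ + _ \in _) => apply: mpowD; mpow_solve
  | |- is_true (- _ \in _) => apply: mpowN; mpow_solve
  | |- is_true (?x * ?y \in mpow ?l) =>
      first [ match goal with
              | hx : is_true (x * y \in mpow ?m) |- _ =>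
                  solve [refine (@mpow_le _ l m (x * y) _ hx); nat_solve]
              end
            | solve [apply: mpowMl; mpow_solve]
            | solve [apply: mpowMr; mpow_solve]
            | match goal with
              | hx : is_true (x \in mpow ?m), hy : is_true (y \in mpow ?n) |- _ =>
                  solve [refine (@mpowM_le _ l m n x y _ hx hy); nat_solve]
              end ]
  | |- is_true (?x \in mpow ?l) =>
      match goal with
      | hx : is_true (x \in mpow ?m) |- _ => solve [refine (@mpow_le _ l m x _ hx); nat_solve]
      end
  end.

Section Parahoric.
Variable k : dvFieldType.
Local Notation O := (integers k).
Local Notation K := (GL3 k).
Implicit Types g h : K.

(** The groups C_c of the statement, for natural-number exponents. *)
Definition par (a b c : nat) : set K :=
  [set g | [/\ entry g 1 0 \in mpow a, entry g 2 1 \in mpow b & entry g 2 0 \in mpow c]].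

Lemma entry_mulgV g i j : entry g i 0 * entry g^-1%g 0 j + entry g i 1 * entry g^-1%g 1 j +
  entry g i 2 * entry g^-1%g 2 j = (i == j)%:R.
Proof. by rewrite -entryM mulgV entry1. Qed.

Lemma entry_mulVg g i j : entry g^-1%g i 0 * entry g 0 j + entry g^-1%g i 1 * entry g 1 j +
  entry g^-1%g i 2 * entry g 2 j = (i == j)%:R.
Proof. by rewrite -entryM mulVg entry1. Qed.

Lemma entry_mulgV0 g i j : i != j -> entry g i 0 * entry g^-1%g 0 j +
  entry g i 1 * entry g^-1%g 1 j + entry g i 2 * entry g^-1%g 2 j = 0.
Proof. by move=> /negPf ij; rewrite entry_mulgV ij. Qed.

Lemma entry_mulVg0 g i j : i != j -> entry g^-1%g i 0 * entry g 0 j +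
  entry g^-1%g i 1 * entry g 1 j + entry g^-1%g i 2 * entry g 2 j = 0.
Proof. by move=> /negPf ij; rewrite entry_mulVg ij. Qed.

Lemma unit_factor (x y s : O) : x * y + s = 1 -> s \in mpow 1 -> x \is a GRing.unit.
Proof.
move=> e s1; have : x * y \is a GRing.unit.
  apply: (@unit_cong k 1 1) (unitr1 _) => //.
  by rewrite -e opprD addrA subrr sub0r rpredN.
by rewrite unitrM => /andP[].
Qed.

Lemma unit22 g : entry g 2 0 \in mpow 1 -> entry g 2 1 \in mpow 1 ->
  entry g 2 2 \is a GRing.unit.
Proof.
move=> g0 g1; have := entry_mulgV g 2 2; rewrite addrC => /unit_factor; apply.
mpow_solve.
Qed.

Lemma unit_diag g :
  entry g 1 0 \in mpow 1 -> entry g 2 0 \in mpow 1 -> entry g 2 1 \in mpow 1 ->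
  entry g 0 0 \is a GRing.unit /\ entry g 1 1 \is a GRing.unit.
Proof.
move=> g10 g20 g21; have u2 := unit22 g20 g21.
have row2 (j : 'I_3) : 2 != j -> entry g^-1%g 2 j \in mpow 1.
  move=> j2; rewrite -(unit_mpowMl _ _ u2).
  have := entry_mulgV0 g j2; rewrite addrC => /eqP.
  by rewrite addr_eq0 => /eqP ->; mpow_solve.
have G20 : entry g^-1%g 2 0 \in mpow 1 by apply: row2.
have G21 : entry g^-1%g 2 1 \in mpow 1 by apply: row2.
have u1 : entry g 1 1 \is a GRing.unit.
  have := entry_mulgV g 1 1; rewrite [X in X + _]addrC -addrA => /unit_factor; apply.
  by mpow_solve.
split=> //.
have G10 : entry g^-1%g 1 0 \in mpow 1.
  rewrite -(unit_mpowMl _ _ u1).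
  have := @entry_mulgV0 g 1 0 isT; rewrite [X in X + _]addrC -addrA => /eqP.
  by rewrite addr_eq0 => /eqP ->; mpow_solve.
have := entry_mulgV g 0 0; rewrite -addrA => /unit_factor; apply.
by mpow_solve.
Qed.

Lemma par1 a b c : par a b c 1%g.
Proof. by split; rewrite entry1 rpred0. Qed.

Lemma parM a b c g h : (a <= c)%N -> (b <= c)%N -> (c <= a + b)%N ->
  par a b c g -> par a b c h -> par a b c (g * h)%g.
Proof. by move=> ac bc cab [g1 g2 g3] [h1 h2 h3]; split; rewrite entryM; mpow_solve. Qed.

(** Only the three equations of g g^-1 = 1 and g^-1 g = 1 that express the
    lower entries of g^-1 are needed, since the diagonal entries they are
    divided by are units. *)
Lemma parV a b c g : (a <= c)%N -> (b <= c)%N -> (c <= a + b)%N -> (0 < b)%N ->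
  par a b c g -> par a b c (g^-1)%g.
Proof.
move=> ac bc cab b0 [g1 g2 g3].
have u2 : entry g 2 2 \is a GRing.unit by apply: unit22; mpow_solve.
have G10 : entry g^-1%g 1 0 \in mpow a.
  have [-> | a0] := posnP a; first exact: int_valP.
  have [u0 _] : entry g 0 0 \is a GRing.unit /\ entry g 1 1 \is a GRing.unit.
    by apply: unit_diag; mpow_solve.
  rewrite -(unit_mpowMr _ _ u0).
  have := @entry_mulVg0 g 1 0 isT; rewrite -addrA => /eqP.
  by rewrite addr_eq0 => /eqP ->; mpow_solve.
split=> //; rewrite -(unit_mpowMl _ _ u2).
  have := @entry_mulgV0 g 2 1 isT; rewrite addrC => /eqP.
  by rewrite addr_eq0 => /eqP ->; mpow_solve.
have := @entry_mulgV0 g 2 0 isT; rewrite addrC => /eqP.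
by rewrite addr_eq0 => /eqP ->; mpow_solve.
Qed.

Lemma par_le a b c a' b' c' g : (a' <= a)%N -> (b' <= b)%N -> (c' <= c)%N ->
  par a b c g -> par a' b' c' g.
Proof. by move=> aa bb cc [g1 g2 g3]; split; mpow_solve. Qed.

Lemma congrE n (g : K) : congr_subgroup n g <->
  forall i j, entry g i j - (i == j)%:R \in mpow n.
Proof.
have E i j : (entry g i j - (i == j)%:R \in mpow n) =
    (int_val (entry g i j) - (i == j)%:R \in ppow n%:Z).
  by rewrite unfold_in; case: (i == j).
by split=> h i j; have := h i j; rewrite E.
Qed.

Lemma congr_diff n (g h : K) : (forall i j, entry g i j - entry h i j \in mpow n) ->
  congr_subgroup n (h^-1 * g)%g /\ congr_subgroup n (g * h^-1)%g.
Proof.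
move=> gh; split; apply/congrE => i j; rewrite entryM.
  rewrite -(entry_mulVg h); set x := (X in X \in _).
  have -> : x = entry h^-1%g i 0 * (entry g 0 j - entry h 0 j) +
     entry h^-1%g i 1 * (entry g 1 j - entry h 1 j) +
     entry h^-1%g i 2 * (entry g 2 j - entry h 2 j) by rewrite /x; ring.
  by rewrite !rpredD // mpowMl.
rewrite -(entry_mulgV h); set x := (X in X \in _).
have -> : x = (entry g i 0 - entry h i 0) * entry h^-1%g 0 j +
   (entry g i 1 - entry h i 1) * entry h^-1%g 1 j +
   (entry g i 2 - entry h i 2) * entry h^-1%g 2 j by rewrite /x; ring.
by rewrite !rpredD // mpowMr.
Qed.

Lemma congr_par a b c n (g : K) : (a <= n)%N -> (b <= n)%N -> (c <= n)%N ->
  congr_subgroup n g -> par a b c g.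
Proof.
move=> an bn cn /congrE gn; split.
- by have := mpow_le an (gn 1 0); rewrite subr0.
- by have := mpow_le bn (gn 2 1); rewrite subr0.
- by have := mpow_le cn (gn 2 0); rewrite subr0.
Qed.

Definition elem i j (t : O) : K :=
  rank1 (fun l => t *+ (l == i)) (fun l => (l == j)%:R).

Lemma entry_elem i j t : 1 + t *+ (i == j) \is a GRing.unit ->
  forall a b, entry (elem i j t) a b = (a == b)%:R + t *+ ((a == i) && (b == j)).
Proof.
move=> u a b; rewrite entry_rank1.
  by rewrite mulr_natr -mulrnA mulnb.
suff -> : (0 == j)%:R * (t *+ (0 == i)) + (1 == j)%:R * (t *+ (1 == i)) +
    (2 == j)%:R * (t *+ (2 == i)) = t *+ (i == j) by [].
by move: i j {u}; do 2![elim/ord3_ind]; rewrite /= ?mul0r ?mul1r ?mulr0n ?addr0 ?add0r.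
Qed.

Lemma entry_conj_elem g i j t a b : 1 + t *+ (i == j) \is a GRing.unit ->
  entry (g * elem i j t * g^-1)%g a b = (a == b)%:R + t * entry g a i * entry g^-1%g j b.
Proof.
move=> u; rewrite -(entry_mulgV g) entryM !(entryM g) !entry_elem //.
by move: i j {u}; do 2![elim/ord3_ind]; rewrite /= ?mulr0n ?mulr1n; ring.
Qed.

End Parahoric.

(** * Finiteness of the residue rings *)

Section FiniteResidue.
Variables (k : dvFieldType) (p q : nat).
Hypothesis hk : padic_field k p q.
Local Notation O := (integers k).
Local Notation K := (GL3 k).

Local Lemma residue_eq (x y : O) :
  (\pi_(residue k)%qT x = \pi_(residue k)%qT y) <-> (x - y \in mpow 1).
Proof.
have -> : (x - y \in mpow 1) = (x == y %[mod residue k])%qT.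
  exact: (Quotient.idealrBE (max_ideal (k := k))).
by split=> [xy|/eqP //]; apply/eqP.
Qed.

Lemma residue_cover : exists s : seq O, forall x, exists2 y, y \in s & x - y \in mpow 1.
Proof.
have /finite_seqP[s sE] : finite_set (@setT (residue k)) by exists q; apply: padic_residue_card hk.
exists (map repr s) => x; exists (repr (\pi_(residue k)%qT x)).
  apply: map_f; have : (@setT (residue k)) (\pi_(residue k)%qT x) by [].
  by rewrite sE.
by apply/residue_eq; rewrite reprK.
Qed.

Lemma p_mpow1 : (p%:R : O) \in mpow 1.
Proof.
have /andP[_ /eqP pR] := padic_residue_char hk.
rewrite -[p%:R]subr0; apply/residue_eq.
have -> : \pi_(residue k)%qT (0 : O) = 0 by rewrite -[RHS](rmorph0 \pi_(residue k)%qT).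
by rewrite -pR rmorph_nat.
Qed.

Lemma p_prime : prime p.
Proof. by have /andP[] := padic_residue_char hk. Qed.

(** A transversal of p^a modulo p^(a+1): finite sums over it play the part of
    sums over the finite group p^a / p^(a+1). *)
Definition transversal a (s : seq O) := [/\ uniq s, {subset s <= mpow a},
  forall x, x \in mpow a -> exists2 y, y \in s & x - y \in mpow a.+1 &
  {in s &, forall x y, x - y \in mpow a.+1 -> x = y}].

Lemma transversal_ex a : exists s, transversal a s.
Proof.
have [s0 cov] := residue_cover; have [w wa wn] := mpow_proper k a.
have thin (t : seq O) : exists s : seq O, [/\ uniq s, {subset s <= t},
    forall x, x \in t -> exists2 y, y \in s & x - y \in mpow a.+1 &
    {in s &, forall x y, x - y \in mpow a.+1 -> x = y}].
  elim: t => [|x t [s [us st sc si]]]; first by exists [::].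
  have [[y ys xy]|nxy] := pselect (exists2 y, y \in s & x - y \in mpow a.+1).
    exists s; split=> // z; first by move=> /st zt; rewrite inE zt orbT.
    by rewrite inE => /orP[/eqP->|/sc //]; exists y.
  exists (x :: s); split.
  - rewrite /= us andbT; apply/negP => xs; apply: nxy; exists x => //.
    by rewrite subrr rpred0.
  - by move=> z; rewrite !inE => /orP[->//|/st ->]; rewrite orbT.
  - move=> z; rewrite inE => /orP[/eqP->|/sc[y ys zy]].
      by exists x; rewrite ?mem_head // subrr rpred0.
    by exists y; rewrite // inE ys orbT.
  - move=> y z; rewrite !inE => /orP[/eqP->|ys] /orP[/eqP->|zs] // yz.
    + by case: nxy; exists z.
    + by case: nxy; exists y; rewrite // -opprB rpredN.
    + exact: si.
have [s [us st sc si]] := thin [seq y * w | y <- s0].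
exists s; split=> // [x /st/mapP[y _ ->]|x xa]; first exact: mpowMl.
have [t t0 tx] := mpow_div wn (leqnn _) xa.
have [y ys ty] := cov t.
have [|z zs yz] := sc (y * w); first exact: map_f.
exists z => //; rewrite -tx -[t](subrK y) mulrDl -addrA rpredD //.
exact: (@mpowM_le _ _ 1 a).
Qed.

Lemma congr_cover n : exists s : seq O, forall x, exists2 y, y \in s & x - y \in mpow n.
Proof.
elim: n => [|n [s sP]]; first by exists [:: 0] => x; exists 0;
  rewrite ?mem_head //; apply: int_valP.
have [t [_ _ tP _]] := transversal_ex n.
exists [seq y + z | y <- s, z <- t] => x.
have [y ys xy] := sP x; have [z zt yz] := tP _ xy.
by exists (y + z); rewrite ?opprD ?addrA //; apply: allpairs_f.
Qed.

Lemma GL3_cover n : exists s : seq K, forall g, exists2 h, h \in s &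
  forall i j, entry g i j - entry h i j \in mpow n.
Proof.
have [s sP] := congr_cover n.
pose near (A : 'M['I_(size s)]_3) g := forall i j, entry g i j - s`_(A i j) \in mpow n.
pose pick A := if pselect (exists g, near A g) is left ex then projT1 (cid ex) else 1%g.
exists [seq pick A | A : 'M['I_(size s)]_3] => g.
have approx x : exists i : 'I_(size s), x - s`_i \in mpow n.
  have [y ys xy] := sP x; have ys' : (index y s < size s)%N by rewrite index_mem.
  by exists (Ordinal ys'); rewrite /= nth_index.
pose A := \matrix_(i < 3, j < 3) projT1 (cid (approx (entry g i j))).
have nA : near A g by move=> i j; rewrite mxE; case: cid.
exists (pick A); first by apply: map_f; rewrite mem_enum.
move=> i j; rewrite /pick; case: pselect => [ex|no]; last by case: no; exists g.
case: cid => h /= nh; rewrite -[entry g i j](subrK s`_(A i j)) -addrA rpredD //.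
by rewrite -opprB rpredN.
Qed.

End FiniteResidue.

(** * An additive character of the residue field *)

Section AdditiveCharacter.
Variables (R : realType) (k : dvFieldType) (p q : nat).
Hypothesis hk : padic_field k p q.
Local Notation C := R[i].
Local Notation O := (integers k).

Lemma root_of_unity : exists2 z : C, z ^+ p = 1 & z != 1.
Proof.
have p_gt1 := prime_gt1 (p_prime hk); set P : {poly C} := \poly_(i < p) 1.
have PE (x : C) : P.[x] = \sum_(i < p) x ^+ i.
  by rewrite horner_poly; apply: eq_bigr => i _; rewrite mul1r.
have /closed_rootP[z /eqP Pz] : size P != 1%N.
  by rewrite size_poly_eq ?oner_neq0 // neq_ltn p_gt1 orbT.
exists z; first by apply/eqP; rewrite -subr_eq0 subrX1 -PE Pz mulr0.
apply: contra_eq_neq Pz => ->; rewrite PE.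
under eq_bigr do rewrite expr1n.
by rewrite sumr_const card_ord pnatr_eq0 -lt0n ltnW.
Qed.

(** Generation of O modulo p by a list, with integer coefficients. *)
Fixpoint spans (s : seq O) (x : O) : Prop :=
  if s is e :: s' then exists j : int, spans s' (x - e *~ j) else x \in mpow 1.

Lemma spansB s x y : spans s x -> spans s y -> spans s (x - y).
Proof.
elim: s x y => [|e s IH] x y /=; first exact: rpredB.
move=> [i xi] [j yj]; exists (i - j).
have -> : x - y - e *~ (i - j) = (x - e *~ i) - (y - e *~ j) by rewrite mulrzBr; ring.
exact: IH.
Qed.

Lemma spans_mpow1 s x : x \in mpow 1 -> spans s x.
Proof.
by elim: s x => //= e s IH x x1; exists 0; rewrite mulr0z subr0; apply: IH.
Qed.

Lemma spansN s x : spans s x -> spans s (- x).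
Proof. by move=> sx; rewrite -sub0r; apply: spansB => //; apply/spans_mpow1/rpred0. Qed.

Lemma spansZ s x (j : int) : spans s x -> spans s (x *~ j).
Proof.
move=> sx; have s0 : spans s 0 by apply: spans_mpow1; apply: rpred0.
have sN y : spans s y -> spans s (- y) by move=> sy; rewrite -sub0r; apply: spansB.
have sn n : spans s (x *+ n).
  elim: n => [|n IH]; rewrite ?mulr0n // mulrSr -[x in _ + x]opprK.
  by apply: spansB => //; apply: spansN.
by case: j => n; rewrite ?NegzE ?mulrNz -pmulrn //; apply: spansN.
Qed.

Lemma spans_mem s x : x \in s -> spans s x.
Proof.
elim: s => //= e s IH; rewrite inE => /orP[/eqP ->|/IH sx].
  by exists 1; rewrite subrr; apply/spans_mpow1/rpred0.
by exists 0; rewrite mulr0z subr0.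
Qed.

(** A nontrivial additive character of the residue field.  In a spanning
    list, discard entries until dropping the next one, e, leaves some element out
    of reach; the residue field being killed by p, the coefficient of e is then
    well defined modulo p, and raising a root of unity of order p to that
    coefficient is the character. *)
Lemma residue_character : exists e : O -> C,
  [/\ forall x y, e (x + y) = e x * e y, forall x, x \in mpow 1 -> e x = 1 &
      exists x, e x != 1].
Proof.
have [z zp z1] := root_of_unity.
have [s0 s0P] : exists s, forall x, spans s x.
  have [s sP] := residue_cover hk; exists s => x; have [y ys xy] := sP x.
  rewrite -[x](subrK y) -[X in _ + X]opprK; apply: spansB; first exact: spans_mpow1.
  by apply/spansN/spans_mem.
elim: s0 s0P => [|e s IH] sP.
  by have := sP 1; rewrite /= => /negPn; rewrite -unit_mpow1 unitr1.
have [/IH //|/existsNP[x0 x0s]] := pselect (forall x, spans s x).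
have z0 : z != 0.
  apply/eqP => z0; move/eqP: zp; rewrite z0 expr0n eqn0Ngt.
  by rewrite prime_gt0 ?(p_prime hk) // eq_sym oner_eq0.
have zdvd (j : int) : (p %| j)%Z -> z ^ j = 1.
  by case/dvdzP=> i ->; rewrite mulrC -exprz_exp -exprnP zp exp1rz.
have e_dvd (j : int) : spans s (e *~ j) -> (p %| j)%Z.
  move=> ej; apply: contrapT => /negP npj; apply: x0s.
  have cop : coprimez p j by rewrite coprimezE prime_coprime ?(p_prime hk) // -dvdzE.
  have [[u v] uv] := coprimezP _ _ cop.
  have es : spans s e.
    have -> : e = e *~ j *~ v - (- (e *~ p%:Z)) *~ u.
      rewrite mulNrz opprK -!mulrzA -mulrzDr [j * v]mulrC [p%:Z * u]mulrC addrC.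
      by rewrite uv mulr1z.
    apply: spansB; apply: spansZ => //; apply: spans_mpow1.
    by rewrite rpredN -pmulrn -mulr_natr mpowMl // (p_mpow1 hk).
  have [j0 x0j] := sP x0.
  rewrite -[x0](subrK (e *~ j0)) -[X in _ + X]opprK; apply: spansB => //.
  by rewrite -mulrNz; apply: spansZ.
pose f x := projT1 (cid (sP x)).
have fP x : spans s (x - e *~ f x) by rewrite /f; case: cid.
have zf x j : spans s (x - e *~ j) -> z ^ f x = z ^ j.
  move=> xj; have /e_dvd/zdvd d : spans s (e *~ (f x - j)).
    have -> : e *~ (f x - j) = (x - e *~ j) - (x - e *~ f x) by rewrite mulrzBr; ring.
    exact: spansB.
  by rewrite -[f x](subrK j) expfzDr // d mul1r.
exists (fun x => z ^ f x); split=> [x y|x x1|].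
- rewrite -expfzDr //; apply: zf.
  have -> : x + y - e *~ (f x + f y) = (x - e *~ f x) - (- (y - e *~ f y)).
    by rewrite mulrzDr; ring.
  by apply: spansB => //; apply: spansN.
- by rewrite (zf _ 0) //= mulr0z subr0; apply: spans_mpow1.
- exists e; rewrite (zf _ 1) ?expr1z // mulr1z subrr; exact/spans_mpow1/rpred0.
Qed.

(** A nontrivial additive character of p^a / p^(a+1), as a function on O;
    its values off p^a are irrelevant. *)
Definition level_character a (theta : O -> C) :=
  [/\ {in mpow a &, forall x y, theta (x + y) = theta x * theta y},
      forall x, x \in mpow a.+1 -> theta x = 1 &
      exists2 x, x \in mpow a & theta x != 1].

Lemma level_character_ex a : exists theta, level_character a theta.
Proof.
have [e [eD e1 [x0 ex0]]] := residue_character.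
have [w wa wn] := mpow_proper k a.
have w0 : w != 0 by apply: contraNneq wn => ->; apply: rpred0.
pose quo x := xget 0 [set t | t * w = x]%classic.
have qE t : quo (t * w) = t.
  by rewrite /quo; case: xgetP => [y -> /(mulIf w0)//|/(_ t) []].
have div b x : (b <= 1)%N -> x \in mpow (a + b) -> exists2 t, t \in mpow b & x = t * w.
  move=> b1 xa; have [||t ta <-] := @mpow_div _ a.+1 (a + b) _ x wn => //; first by lia.
  by exists t; rewrite // (mpow_le _ ta) //; lia.
exists (e \o quo); split=> [x y|x|] /=.
- rewrite -[a]addn0 => /div[]// t _ -> /div[]// u _ ->.
  by rewrite -mulrDl !qE eD.
- by rewrite -addn1 => /div[]// t t1 ->; rewrite qE e1.
- by exists (x0 * w); rewrite ?qE ?mpowMl.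
Qed.

End AdditiveCharacter.

(** * Fourier analysis on p^a / p^(a+1) *)

Section Fourier.
Variables (R : realType) (k : dvFieldType).
Local Notation C := R[i].
Local Notation O := (integers k).

Definition periodic a (phi : O -> C) :=
  {in mpow a &, forall x y, x - y \in mpow a.+1 -> phi x = phi y}.

(** A self-map of p^a that is injective modulo p^(a+1) permutes a
    transversal up to congruence. *)
Lemma sum_reindex a s phi (sigma : O -> O) : transversal a s -> periodic a phi ->
  {in mpow a, forall x, sigma x \in mpow a} ->
  {in mpow a &, forall x y, sigma x - sigma y \in mpow a.+1 -> x - y \in mpow a.+1} ->
  \sum_(x <- s) phi (sigma x) = \sum_(x <- s) phi x.
Proof.
move=> [us sa sc si] per siga sig_inj.
pose r x := xget 0 [set y | y \in s /\ x - y \in mpow a.+1]%classic.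
have rP x : x \in mpow a -> r x \in s /\ x - r x \in mpow a.+1.
  by move=> /sc[y ys xy]; rewrite /r; case: xgetP => [z -> []//|/(_ y)]; case.
have E : \sum_(x <- s) phi (sigma x) = \sum_(x <- map (r \o sigma) s) phi x.
  rewrite big_map; apply: eq_big_seq => x /sa xa /=.
  by have [/sa ra xr] := rP _ (siga _ xa); apply: per => //; apply: siga.
have ur : uniq (map (r \o sigma) s).
  rewrite map_inj_in_uniq // => x y xs ys /= e; apply: si => //.
  have [xa ya] := (sa _ xs, sa _ ys); apply: sig_inj => //.
  have [_ h1] := rP _ (siga _ xa); have [_ h2] := rP _ (siga _ ya).
  rewrite -[sigma x](subrK (r (sigma x))) {2}e -addrA rpredD //.
  by rewrite -opprB rpredN.
have sub : {subset map (r \o sigma) s <= s}.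
  by move=> _ /mapP[x /sa/siga xa ->] /=; have [] := rP _ xa.
have [_ eqs] := uniq_min_size ur sub (eq_leq (esym (size_map (r \o sigma) s))).
by rewrite E; apply: perm_big; apply: uniq_perm.
Qed.

Variables (a : nat) (theta : O -> C) (s0 sa : seq O).
Hypothesis thetaP : level_character a theta.
Hypotheses (s0P : transversal 0 s0) (saP : transversal a sa).

Lemma theta0 : theta 0 = 1.
Proof. by have [_ -> //] := thetaP; rewrite rpred0. Qed.

Lemma thetaD x y : x \in mpow a -> y \in mpow a -> theta (x + y) = theta x * theta y.
Proof. by have [tD _ _] := thetaP; apply: tD. Qed.

Lemma theta_periodic : periodic a theta.
Proof.
have [tD t1 _] := thetaP => x y xa ya xy.
by rewrite -(subrK y x) thetaD ?rpredB // t1 ?mul1r.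
Qed.

Lemma theta_cong x y : y \in mpow a -> x - y \in mpow a.+1 -> theta x = theta y.
Proof.
move=> ya xy; apply: theta_periodic => //.
by rewrite -(subrK y x) rpredD // (mpow_le _ xy).
Qed.

Lemma theta_separates y : y \in mpow a -> y \notin mpow a.+1 ->
  exists t, theta (t * y) != 1.
Proof.
move=> ya yn; have [_ _ [x xa tx]] := thetaP.
by have [t _ e] := mpow_div yn (leqnn _) xa; exists t; rewrite e.
Qed.

Lemma sum_theta : \sum_(x <- sa) theta x = 0.
Proof.
have [_ _ [z za tz]] := thetaP.
have : \sum_(x <- sa) theta x * (theta z - 1) = 0.
  rewrite -mulr_suml mulrBr mulr1 -[in X in _ - X](@sum_reindex a sa theta (fun x => x + z)) //.
  - rewrite mulr_suml; apply/eqP; rewrite subr_eq0; apply/eqP/eq_big_seq => x xs.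
    by rewrite thetaD //; have [_ -> //] := saP.
  - exact: theta_periodic.
  - by move=> x xa; rewrite rpredD.
  - by move=> x y xa ya; rewrite opprD addrACA subrr addr0.
by rewrite -mulr_suml => /eqP; rewrite mulf_eq0 subr_eq0 (negPf tz) orbF => /eqP.
Qed.

Lemma sum_theta_scale y : y \in mpow a ->
  \sum_(t <- s0) theta (t * y) = if y \in mpow a.+1 then (size s0)%:R else 0.
Proof.
move=> ya; have [_ t1 _] := thetaP; case: ifPn => [y1|yn].
  rewrite (eq_bigr (fun=> 1)) => [|t _]; last by rewrite t1 // mpowMl.
  by rewrite big_const_seq count_predT -Monoid.iteropE /=; elim: (size s0).
have [z tz] := theta_separates ya yn.
have per : periodic 0 (fun t => theta (t * y)).
  move=> t u _ _ tu; apply: theta_cong; first exact: mpowMl.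
  by rewrite -mulrBl; apply: (@mpowM_le _ _ 1 a).
have : \sum_(t <- s0) theta (t * y) * (theta (z * y) - 1) = 0.
  rewrite -mulr_suml mulrBr mulr1.
  rewrite -[in X in _ - X](sum_reindex (sigma := fun x => x + z) s0P per) //.
  - rewrite mulr_suml; apply/eqP; rewrite subr_eq0; apply/eqP/eq_bigr => x _.
    by rewrite mulrDl thetaD // mpowMl.
  - by move=> x xa; rewrite rpredD //; apply: int_valP.
  - by move=> x y' xa ya'; rewrite opprD addrACA subrr addr0.
by rewrite -mulr_suml => /eqP; rewrite mulf_eq0 subr_eq0 (negPf tz) orbF => /eqP.
Qed.

(** The characters y |-> theta (t y), for t modulo p, exhaust the dual of
    p^a / p^(a+1). *)
Lemma fourier_inversion phi : periodic a phi ->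
  \sum_(t <- s0) \sum_(y <- sa) theta (t * y) * phi y = (size s0)%:R * phi 0.
Proof.
move=> per; have [us sa_a sc si] := saP; rewrite exchange_big /=.
have [y0 y0s y01'] := sc 0 (mpow_0 _ _).
have y01 : y0 \in mpow a.+1 by move/mpowN: y01'; rewrite opprB subr0.
rewrite (bigD1_seq y0) //= -mulr_suml sum_theta_scale ?sa_a // y01.
rewrite big_seq_cond big1 ?addr0 => [|y /andP[ys yy0]].
  by congr (_ * _); apply: per; [exact: sa_a|exact: mpow_0|rewrite subr0].
rewrite -mulr_suml sum_theta_scale ?sa_a // ifN ?mul0r //.
apply: contra yy0 => y1; apply/eqP/si => //; exact: rpredB.
Qed.

Lemma size_s0 : (size s0)%:R != 0 :> C.
Proof.
rewrite pnatr_eq0; have [_ _ sc _] := s0P; have [y + _] := sc 0 (mpow_0 _ _).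
by case: (s0).
Qed.

Lemma shift_periodic phi z : z \in mpow a -> periodic a phi ->
  periodic a (fun y => phi (y + z)).
Proof.
move=> za per x y xa ya xy; apply: per; [exact: rpredD|exact: rpredD|].
by rewrite opprD addrACA subrr addr0.
Qed.

Lemma fourier_zero phi : periodic a phi ->
  (forall t, \sum_(y <- sa) theta (t * y) * phi y = 0) -> phi 0 = 0.
Proof.
move=> per h; apply: (mulfI size_s0); rewrite -fourier_inversion // mulr0.
by rewrite big1.
Qed.

(** A function whose nontrivial Fourier coefficients all vanish is constant.
    The translates by z stand for the fact that the vanishing is used at every
    point, not only for the expansion at 0. *)
Lemma fourier_const phi : periodic a phi ->
  (forall t z, t \is a GRing.unit -> z \in mpow a ->
    \sum_(y <- sa) theta (t * y) * phi (y + z) = 0) ->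
  forall z, z \in mpow a -> phi z = phi 0.
Proof.
move=> per h.
have [_ t1 _] := thetaP; have [us sa_a _ _] := saP; have [us0 _ sc0 si0] := s0P.
have [t0 t0s t01'] := sc0 0 (mpow_0 _ _).
have t01 : t0 \in mpow 1 by move/mpowN: t01'; rewrite opprB subr0.
suff E z : z \in mpow a -> (size s0)%:R * phi z = \sum_(y <- sa) phi y.
  by move=> z za; apply: (mulfI size_s0); rewrite !E ?rpred0.
move=> za; have := fourier_inversion (shift_periodic za per).
rewrite add0r => <-; rewrite (bigD1_seq t0) //= [X in _ + X]big1_seq ?addr0.
  rewrite -[RHS](@sum_reindex a sa phi (fun y => y + z)) //.
  - by apply: eq_big_seq => y /sa_a ya; rewrite t1 ?mul1r // (@mpowM_le _ _ 1 a).
  - by move=> x xa; rewrite rpredD.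
  - by move=> x y xa ya; rewrite opprD addrACA subrr addr0.
move=> t /andP[tt0 ts]; apply: h => //; rewrite unit_mpow1.
by apply: contra tt0 => t1'; apply/eqP/si0 => //; apply: rpredB.
Qed.

End Fourier.

(** * The inducing characters *)

Section InducingCharacter.
Variables (R : realType) (k : dvFieldType).
Local Notation C := R[i].
Local Notation O := (integers k).
Local Notation K := (GL3 k).

Section OneCharacter.
Variables (psi : units O -> units C) (n : nat).
Hypothesis psiM : forall u v, psi (u * v)%g = (psi u * psi v)%g.

Lemma ev_unit (u : units O) : ev psi (units_val u) = units_val (psi u).
Proof. by rewrite /ev (valK u). Qed.

Lemma ev_mul x y : x \is a GRing.unit -> y \is a GRing.unit ->
  ev psi (x * y) = ev psi x * ev psi y.
Proof.
move=> ux uy; have -> : x * y = units_val (Units ux * Units uy)%g by [].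
by rewrite ev_unit psiM [LHS]/= -!ev_unit.
Qed.

Lemma ev1 : ev psi 1 = 1.
Proof.
have p1 : psi 1%g = 1%g by apply: (mulgI (psi 1%g)); rewrite -psiM !mulg1.
by have := ev_unit 1%g; rewrite p1.
Qed.

Lemma ev_cong x y : trivial_at psi n -> x \is a GRing.unit -> y \is a GRing.unit ->
  y - x \in mpow n -> ev psi y = ev psi x.
Proof.
move=> triv ux uy xy.
have uz : y / x \is a GRing.unit by rewrite unitrM uy unitrV.
rewrite -[y](divrK ux) ev_mul //.
have -> : ev psi (y / x) = 1.
  have := ev_unit (Units uz); rewrite triv //.
  suff : y / x - 1 \in mpow n by [].
  by rewrite -(divrr ux) -mulrBl mpowMr.
by rewrite mul1r.
Qed.
End OneCharacter.

Variables (chi2 chi3 : units O -> units C) (M N : nat).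
Hypothesis chi2M : forall u v, chi2 (u * v)%g = (chi2 u * chi2 v)%g.
Hypothesis chi3M : forall u v, chi3 (u * v)%g = (chi3 u * chi3 v)%g.
Hypothesis triv2 : trivial_at chi2 M.
Hypothesis triv3 : trivial_at chi3 N.
Hypothesis N0 : (0 < N)%N.
Local Notation chi := (chi_ chi2 chi3 M).

Lemma chi_cong (g h : K) :
  ((0 < M)%N -> entry g 1 1 \is a GRing.unit) -> entry g 2 2 \is a GRing.unit ->
  entry h 1 1 - entry g 1 1 \in mpow M -> entry h 2 2 - entry g 2 2 \in mpow N ->
  chi h = chi g.
Proof.
move=> u1 u2 c1 c2; rewrite /chi_.
congr (_ * _); last by apply: ev_cong (c2) => //; apply: unit_cong c2 u2.
case: posnP u1 c1 => // M0 u1 c1; apply: ev_cong (c1) => //; first exact: u1.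
by apply: unit_cong c1 _ => //; apply: u1.
Qed.

Lemma chi1 (g : K) : entry g 1 1 - 1 \in mpow M -> entry g 2 2 - 1 \in mpow N -> chi g = 1.
Proof.
move=> c1 c2; rewrite (@chi_cong 1%g) ?entry1 ?unitr1 //.
by rewrite /chi_ !entry1 !ev1 // if_same mulr1.
Qed.

Lemma par_unit (g : K) : (M <= N)%N -> par M N N g ->
  ((0 < M)%N -> entry g 1 1 \is a GRing.unit) /\ entry g 2 2 \is a GRing.unit.
Proof.
move=> MN [g1 g2 g3]; split; last by apply: unit22; mpow_solve.
move=> M0; have [] : entry g 0 0 \is a GRing.unit /\ entry g 1 1 \is a GRing.unit.
  by apply: unit_diag; mpow_solve.
by [].
Qed.

(** Multiplicativity on the largest group that occurs, C_(M, N, N): there the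
    diagonal entries of a product are the products of the diagonal entries up to
    p^M and p^N. *)
Lemma chiM (g h : K) : (M <= N)%N -> par M N N g -> par M N N h ->
  chi (g * h)%g = chi g * chi h.
Proof.
move=> MN pg ph; have [u1 u2] := par_unit MN pg; have [v1 v2] := par_unit MN ph.
have [_ w2] : ((0 < M)%N -> entry (g * h)%g 1 1 \is a GRing.unit) /\
    entry (g * h)%g 2 2 \is a GRing.unit.
  by apply: par_unit => //; apply: parM => //; lia.
case: pg => [g1 g2 g3]; case: ph => [h1 h2 h3].
have c1 : entry (g * h)%g 1 1 - entry g 1 1 * entry h 1 1 \in mpow M.
  rewrite entryM; set x := (X in X - _).
  have -> : x - entry g 1 1 * entry h 1 1 =
      entry g 1 0 * entry h 0 1 + entry g 1 2 * entry h 2 1 by rewrite /x; ring.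
  mpow_solve.
have c2 : entry (g * h)%g 2 2 - entry g 2 2 * entry h 2 2 \in mpow N.
  rewrite entryM; set x := (X in X - _).
  have -> : x - entry g 2 2 * entry h 2 2 =
      entry g 2 0 * entry h 0 2 + entry g 2 1 * entry h 1 2 by rewrite /x; ring.
  mpow_solve.
rewrite /chi_ mulrACA; congr (_ * _).
  case: posnP u1 v1 c1 => [|M0] u1 v1 c1; first by rewrite mulr1.
  rewrite -ev_mul ?u1 ?v1 //; apply: ev_cong (c1) => //; rewrite ?unitrM ?u1 ?v1 //.
  by apply: unit_cong c1 _ => //; rewrite unitrM u1 ?v1.
by rewrite -ev_mul //; apply: ev_cong (c2) => //; rewrite unitrM u2.
Qed.

End InducingCharacter.

(** * Intertwining of the stabilizer of a level character *)

Section Stabilizer.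
Variables (k : dvFieldType) (mu nu a : nat).
Hypotheses (mu0 : (0 < mu)%N) (nu0 : (0 < nu)%N) (aE : a.+1 = (mu + nu)%N).
Local Notation K := (GL3 k).
Implicit Types g h : K.

(** In C_(mu, nu, a), with a = mu + nu - 1, the stabilizer of the additive
    character g |-> theta (g20 / g22) of the last lower entry modulo p^(a+1): the
    torus scales that entry by g00 / g22, which has to be 1 modulo p. *)
Definition stab : set K :=
  [set g | par mu nu a g /\ entry g 0 0 - entry g 2 2 \in mpow 1].
Lemma stab1 : stab 1%g.
Proof. by split; [exact: par1 | rewrite !entry1 subrr mpow_0]. Qed.

Lemma stabM g h : stab g -> stab h -> stab (g * h)%g.
Proof.
move=> [pg dg] [ph dh]; split; first by apply: parM => //; lia.
case: pg => [g1 g2 g3]; case: ph => [h1 h2 h3]; rewrite !entryM.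
set x := (X in X \in _).
have -> : x = (entry g 0 0 - entry g 2 2) * entry h 0 0 +
    entry g 2 2 * (entry h 0 0 - entry h 2 2) +
    (entry g 0 1 * entry h 1 0 + entry g 0 2 * entry h 2 0) -
    (entry g 2 0 * entry h 0 2 + entry g 2 1 * entry h 1 2) by rewrite /x; ring.
by rewrite {}/x; mpow_solve.
Qed.

Lemma stab_congr g : congr_subgroup a g -> stab g.
Proof.
move=> ga; split; first by apply: congr_par ga; lia.
move/congrE: ga => ga; have a1 : (1 <= a)%N by lia.
have -> : entry g 0 0 - entry g 2 2 = (entry g 0 0 - 1) - (entry g 2 2 - 1) by ring.
by rewrite rpredB // (mpow_le a1).
Qed.

End Stabilizer.

Section StabilizerOfLevelCharacter.
Variables (R : realType) (k : dvFieldType).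
Local Notation C := R[i].
Local Notation O := (integers k).
Local Notation K := (GL3 k).
Variables (chi2 chi3 : units O -> units C) (M N : nat).
Hypothesis chi2M : forall u v, chi2 (u * v)%g = (chi2 u * chi2 v)%g.
Hypothesis chi3M : forall u v, chi3 (u * v)%g = (chi3 u * chi3 v)%g.
Hypothesis triv2 : trivial_at chi2 M.
Hypothesis triv3 : trivial_at chi3 N.
Hypothesis N0 : (0 < N)%N.
Local Notation chi := (chi_ chi2 chi3 M).
Variables (mu nu a : nat) (theta : O -> C).
Hypotheses (mu0 : (0 < mu)%N) (aE : a.+1 = (mu + nu)%N).
Hypotheses (Mmu : (M <= mu)%N) (Nnu : (N <= nu)%N).
Hypothesis thetaP : level_character a theta.

Local Notation stab := (stab mu nu a).

Definition stab_char (g : K) : C := chi g * theta (entry g 2 0 / entry g 2 2).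

Lemma stab_char_near1 h : entry h 2 0 \in mpow a ->
  entry h 1 1 - 1 \in mpow M -> entry h 2 2 - 1 \in mpow N ->
  stab_char h = theta (entry h 2 0).
Proof.
move=> h20 h11 h22; rewrite /stab_char (chi1 chi2M chi3M triv2 triv3) // mul1r.
have u : entry h 2 2 \is a GRing.unit by apply: unit_cong h22 (unitr1 _).
apply: (theta_cong thetaP) => //.
have -> : entry h 2 0 / entry h 2 2 - entry h 2 0 =
    - (entry h 2 0 * ((entry h 2 2 - 1) / entry h 2 2)).
  by rewrite mulrBl divrr // mul1r; ring.
have d : (entry h 2 2 - 1) / entry h 2 2 \in mpow 1 by rewrite mpowMr // (mpow_le _ h22).
by mpow_solve.
Qed.

(** A character trivial on p^(a+1) and not on p^a separates units from p. *)
Lemma theta_detect c : (forall t, t \in mpow a -> theta (t * c) = 1) -> c \in mpow 1.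
Proof.
move=> tc; apply: contrapT => /negP; rewrite -unit_mpow1 => uc.
have [_ _ [s sa]] := thetaP; apply/negP/negPn/eqP.
by rewrite -(divrK uc s); apply: tc; rewrite mpowMr.
Qed.

Lemma elem_diag (i j : 'I_3) (t : O) : t \in mpow 1 -> 1 + t *+ (i == j) \is a GRing.unit.
Proof.
move=> t1; apply: (@unit_cong _ 1 1) (unitr1 _) => //.
by rewrite addrC addKr; case: (i == j); rewrite ?mulr0n ?mpow_0.
Qed.

Section Intertwining.
Variable g : K.
Hypothesis intw : forall b h, stab b -> stab h -> stab ((b * g) * h * (b * g)^-1)%g ->
  stab_char h = stab_char ((b * g) * h * (b * g)^-1)%g.

(** Testing g against 1 + t E_ij with t in p^a.  On these elements the
    inducing character is X |-> theta (tr (E_02 X)), so an intertwiner g commutes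
    with the elementary matrix E_02 modulo p. *)
Lemma intertwiner_mod_p i j :
  entry g 2 i * entry g^-1%g j 0 - ((2 == i) && (j == 0))%:R \in mpow 1.
Proof.
apply: theta_detect => t ta; have t1 : t \in mpow 1 by mpow_solve.
have u := elem_diag i j t1.
have low (c : 'I_3 -> 'I_3 -> O) (h : K) :
    (forall x y, entry h x y = (x == y)%:R + t * c x y) ->
    [/\ stab h, entry h 1 1 - 1 \in mpow M & entry h 2 2 - 1 \in mpow N].
  move=> hE; split; last 2 first.
  - by rewrite hE addrC addKr; mpow_solve.
  - by rewrite hE addrC addKr; mpow_solve.
  split; first by split; rewrite hE add0r; mpow_solve.
  by rewrite !hE opprD addrACA subrr add0r; mpow_solve.
have eE x y : entry (elem i j t) x y = (x == y)%:R + t * ((x == i) && (y == j))%:R.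
  by rewrite entry_elem // mulr_natr.
have cE x y : entry (g * elem i j t * g^-1)%g x y =
    (x == y)%:R + t * (entry g x i * entry g^-1%g j y).
  by rewrite entry_conj_elem // mulrA.
have [se e1 e2] := low _ _ eE; have [sc c1 c2] := low _ _ cE.
have := intw (stab1 _ _ _ _) se; rewrite mul1g => /(_ sc).
rewrite !stab_char_near1 //; last 2 first.
- by case: sc => [[]].
- by case: se => [[]].
rewrite eE cE !add0r eq_sym [j == 0]eq_sym => e.
by rewrite mulrBr (thetaD thetaP) ?mpowMr // ?rpredN ?mpowMr // -e
  -(thetaD thetaP) ?rpredN ?mpowMr // subrr (theta0 thetaP).
Qed.

Lemma intertwiner_upper_mod_p : [/\ entry g 2 2 \is a GRing.unit,
  entry g 1 0 \in mpow 1, entry g 2 0 \in mpow 1, entry g 2 1 \in mpow 1 &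
  entry g 0 0 - entry g 2 2 \in mpow 1].
Proof.
have P i j : ((2 == i) && (j == 0)) = false -> entry g 2 i * entry g^-1%g j 0 \in mpow 1.
  by move=> ij; have := intertwiner_mod_p i j; rewrite ij subr0.
have e22 := intertwiner_mod_p 2 0; rewrite !eqxx /= in e22.
have := unit_cong (isT : (0 < 1)%N) e22 (unitr1 _).
rewrite unitrM => /andP[u2 U0].
have g20 : entry g 2 0 \in mpow 1 by have := P 0 0 erefl; rewrite unit_mpowMr.
have g21 : entry g 2 1 \in mpow 1 by have := P 1 0 erefl; rewrite unit_mpowMr.
have G10 : entry g^-1%g 1 0 \in mpow 1 by have := P 2 1 erefl; rewrite unit_mpowMl.
have G20 : entry g^-1%g 2 0 \in mpow 1 by have := P 2 2 erefl; rewrite unit_mpowMl.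
split=> //.
  rewrite -(unit_mpowMr _ _ U0); have := @entry_mulgV0 _ g 1 0 isT.
  by rewrite -addrA => /eqP; rewrite addr_eq0 => /eqP ->; mpow_solve.
rewrite -(unit_mpowMr _ _ U0) mulrBl; have := entry_mulgV g 0 0; rewrite eqxx => e.
have -> : entry g 0 0 * entry g^-1%g 0 0 =
   1 - (entry g 0 1 * entry g^-1%g 1 0 + entry g 0 2 * entry g^-1%g 2 0).
  by rewrite -[1]e; ring.
rewrite addrAC -[1 - _]opprB; mpow_solve.
Qed.

(** An upper triangular element of the stabilizer; left multiplication by it
    clears the last column of g above the diagonal and keeps the coset of g. *)
Local Definition clear_last_column : K :=
  rank1 (fun i => if i == 2 then 0 else - (entry g i 2 / entry g 2 2)) (fun j => (j == 2)%:R).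

Lemma entry_clear_last_column i j : entry clear_last_column i j =
  (i == j)%:R - (if i == 2 then 0 else entry g i 2 / entry g 2 2) * (j == 2)%:R.
Proof.
rewrite entry_rank1 /=; last by rewrite !(mul0r, mulr0, addr0) unitr1.
by case: (i == 2); rewrite ?mulNr // !mul0r subr0 addr0.
Qed.

Lemma stab_clear_last_column : stab clear_last_column.
Proof.
split; first by split; rewrite entry_clear_last_column /= ?mulr0 ?subr0 mpow_0.
by rewrite !entry_clear_last_column /= mulr0 mul0r subrr mpow_0.
Qed.

Lemma entry_clear_last_columnM i j : entry (clear_last_column * g)%g i j =
  entry g i j - (if i == 2 then 0 else entry g i 2 / entry g 2 2) * entry g 2 j.
Proof.
rewrite entryM !entry_clear_last_column; move: i.
by elim/ord3_ind; rewrite /= ?mulr0n ?mulr1n; ring.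
Qed.

(** Once g is upper triangular modulo p with its last column cleared, to x say,
    three kinds of test elements push the lower entries into the required
    ideals one at a time.  If an entry were too large, [mpow_div] would choose the
    parameter of the test element so that the lower corner of its conjugate by x
    is the point s where theta is nontrivial, while all the other entries stay
    in the stabilizer: 1 + t E_21 does this for the entry 10 of x^-1,
    1 + t E_10 for the entry 21 of x, and the dilations 1 + t E_00 for the
    entry 20 of x. *)
Lemma intertwiner_stab : stab g.
Proof.
have [u2 g10 g20 g21 g02] := intertwiner_upper_mod_p.
set x := (clear_last_column * g)%g.
have x2 j : entry x 2 j = entry g 2 j by rewrite entry_clear_last_columnM /= mul0r subr0.
have x02 : entry x 0 2 = 0 by rewrite entry_clear_last_columnM /= divrK // subrr.
have x12 : entry x 1 2 = 0 by rewrite entry_clear_last_columnM /= divrK // subrr.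
have x10 : entry x 1 0 \in mpow 1 by rewrite entry_clear_last_columnM /=; mpow_solve.
have x20 : entry x 2 0 \in mpow 1 by rewrite x2.
have x21 : entry x 2 1 \in mpow 1 by rewrite x2.
have xu2 : entry x 2 2 \is a GRing.unit by rewrite x2.
have [u0 u1] := unit_diag x10 x20 x21.
have X02 : entry x^-1%g 0 2 = 0.
  have := @entry_mulVg0 _ x 0 2 isT; rewrite x02 x12 !mulr0 !add0r => /eqP.
  by rewrite mulf_eq0 => /orP[/eqP //|/eqP x0]; move: xu2; rewrite x0 unitr0.
have X12 : entry x^-1%g 1 2 = 0.
  have := @entry_mulVg0 _ x 1 2 isT; rewrite x02 x12 !mulr0 !add0r => /eqP.
  by rewrite mulf_eq0 => /orP[/eqP //|/eqP x0]; move: xu2; rewrite x0 unitr0.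
have X10' : entry x^-1%g 1 0 \in mpow 1.
  rewrite -(unit_mpowMl _ _ u1); have := @entry_mulgV0 _ x 1 0 isT.
  by rewrite x12 mul0r addr0 addrC => /eqP; rewrite addr_eq0 => /eqP ->; mpow_solve.
have X0u : entry x^-1%g 0 0 \is a GRing.unit.
  have := entry_mulgV x 0 0; rewrite -addrA mulrC => /unit_factor; apply.
  by rewrite x02 mul0r addr0; mpow_solve.
have test i j t : 1 + t *+ (i == j) \is a GRing.unit ->
    stab (elem i j t) -> entry (elem i j t) 1 1 = 1 -> entry (elem i j t) 2 2 = 1 ->
    entry (elem i j t) 2 0 = 0 -> t * entry x 1 i * entry x^-1%g j 0 \in mpow mu ->
    t * entry x 2 i * entry x^-1%g j 1 \in mpow nu ->
    t * entry x 2 i * entry x^-1%g j 0 \in mpow a ->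
    t * entry x 0 i * entry x^-1%g j 0 \in mpow 1 ->
    t * entry x 1 i * entry x^-1%g j 1 \in mpow M ->
    t * entry x 2 i * entry x^-1%g j 2 \in mpow N ->
    theta (t * entry x 2 i * entry x^-1%g j 0) = 1.
  move=> u se e11 e22 e20 c10 c21 c20 c00 c11 c22.
  have cE := entry_conj_elem x _ _ u.
  have := intw stab_clear_last_column se.
  rewrite -/x !stab_char_near1 ?e11 ?e22 ?e20 ?subrr ?mpow_0 //.
  - rewrite cE add0r (theta0 thetaP) => -> //.
    split; first by split; rewrite cE add0r.
    by rewrite !cE opprD addrACA subrr add0r; mpow_solve.
  - by rewrite cE add0r.
  - by rewrite cE addrC addKr.
  - by rewrite cE addrC addKr.
have [_ _ [s sa ts]] := thetaP.
(* the test element is 1 + t E_21 *)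
have X10 : entry x^-1%g 1 0 \in mpow mu.
  apply: contrapT => /negP X10n.
  have uX : entry x 2 2 * entry x^-1%g 1 0 \notin mpow mu by rewrite unit_mpowMl.
  have [|t tnu te] := mpow_div uX _ sa; first by nat_solve.
  have tnu' : t \in mpow nu by apply: mpow_le tnu; nat_solve.
  move/negP: ts; apply; apply/eqP; rewrite -te mulrA.
  have tu : 1 + t *+ (2 == 1 :> 'I_3) \is a GRing.unit by rewrite addr0 unitr1.
  apply: test => //; rewrite ?entry_elem //= ?mulr0n ?addr0 //.
  - split; first by split; rewrite entry_elem //= ?mulr0n ?mulr1n ?addr0 ?add0r ?mpow_0.
    by rewrite !entry_elem //= !mulr0n !addr0 subrr mpow_0.
  - by rewrite x12 mulr0 mul0r mpow_0.
  - by mpow_solve.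
  - by rewrite -mulrA te.
  - by rewrite x02 mulr0 mul0r mpow_0.
  - by rewrite x12 mulr0 mul0r mpow_0.
  - by rewrite X12 mulr0 mpow_0.
(* the test element is 1 + t E_10 *)
have x21' : entry x 2 1 \in mpow nu.
  apply: contrapT => /negP x21n.
  have uX : entry x 2 1 * entry x^-1%g 0 0 \notin mpow nu by rewrite unit_mpowMr.
  have [|t tmu te] := mpow_div uX _ sa; first by nat_solve.
  have tmu' : t \in mpow mu by apply: mpow_le tmu; nat_solve.
  move/negP: ts; apply; apply/eqP; rewrite -te mulrA.
  have tu : 1 + t *+ (1 == 0 :> 'I_3) \is a GRing.unit by rewrite addr0 unitr1.
  have tx : t * entry x 2 1 \in mpow a by rewrite -(unit_mpowMr _ _ X0u) -mulrA te.
  apply: test => //; rewrite ?entry_elem //= ?mulr0n ?addr0 //.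
  - split; first by split; rewrite entry_elem //= ?mulr0n ?mulr1n ?addr0 ?add0r ?mpow_0.
    by rewrite !entry_elem //= !mulr0n !addr0 subrr mpow_0.
  - by mpow_solve.
  - by mpow_solve.
  - by rewrite -mulrA te.
  - by mpow_solve.
  - by mpow_solve.
  - by rewrite X02 mulr0 mpow_0.
have x10' : entry x 1 0 \in mpow mu.
  rewrite -(unit_mpowMr _ _ X0u); have := @entry_mulgV0 _ x 1 0 isT.
  by rewrite x12 mul0r addr0 => /eqP; rewrite addr_eq0 => /eqP ->; mpow_solve.
(* the test element is 1 + t E_00 *)
have x20' : entry x 2 0 \in mpow a.
  apply: contrapT => /negP x20n.
  have uX : entry x 2 0 * entry x^-1%g 0 0 \notin mpow a by rewrite unit_mpowMr.
  have [|t t1 te] := mpow_div uX _ sa; first by nat_solve.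
  have t1' : t \in mpow 1 by apply: mpow_le t1; nat_solve.
  move/negP: ts; apply; apply/eqP; rewrite -te mulrA.
  have tu := elem_diag 0 0 t1'.
  have tx : t * entry x 2 0 \in mpow a by rewrite -(unit_mpowMr _ _ X0u) -mulrA te.
  apply: test => //; rewrite ?entry_elem //= ?mulr0n ?addr0 //.
  - split; first by split; rewrite entry_elem //= ?mulr0n ?mulr1n ?addr0 ?add0r ?mpow_0.
    by rewrite !entry_elem //= mulr0n mulr1n addr0 addrC addKr.
  - by mpow_solve.
  - by mpow_solve.
  - by rewrite -mulrA te.
  - by mpow_solve.
  - by mpow_solve.
  - by rewrite X02 mulr0 mpow_0.
split=> //; split; rewrite -?x2 //.
have -> : entry g 1 0 = entry x 1 0 + entry g 1 2 / entry g 2 2 * entry x 2 0.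
  by rewrite entry_clear_last_columnM /= x2 subrK.
by mpow_solve.
Qed.
End Intertwining.

Lemma stab_no_intertwiner g : ~ stab g -> exists b h h',
  [/\ stab b, stab h, stab h', (b * g * h = h' * (b * g))%g & stab_char h != stab_char h'].
Proof.
move=> ng; apply: contrapT => no; apply/ng/intertwiner_stab => b h sb sh sc.
apply: contrapT => /eqP ne; apply: no.
by exists b, h, ((b * g) * h * (b * g)^-1)%g; split; rewrite // mulgVK.
Qed.
End StabilizerOfLevelCharacter.

(** * Fourier coefficients along shears *)

Section Shears.
Variables (R : realType) (k : dvFieldType).
Local Notation C := R[i].
Local Notation O := (integers k).
Local Notation K := (GL3 k).
Implicit Types (g h : K) (y z : O).

(** The shears represent the cosets of C_c in the larger groups that occur.
    The definition is locked to keep unification from unfolding it to matrices. *)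
Definition shear : O -> O -> K := locked (fun y z =>
  rank1 (fun i => (i == 2)%:R) (fun j => if j == 0 then y else if j == 1 then z else 0)).

Lemma entry_shear y z i j : entry (shear y z) i j =
  (i == j)%:R + (i == 2)%:R * (if j == 0 then y else if j == 1 then z else 0).
Proof. by rewrite /shear -lock entry_rank1 //= !(mulr0, mul0r, addr0) unitr1. Qed.

Lemma shearD y z y' z' : (shear y z * shear y' z')%g = shear (y + y') (z + z').
Proof.
apply: entry_inj => i j; rewrite entryM !entry_shear.
by move: i j; do 2![elim/ord3_ind]; rewrite /= ?mulr0n ?mulr1n; ring.
Qed.

Lemma shear0 : shear 0 0 = 1%g.
Proof.
apply: entry_inj => i j; rewrite entry1 !entry_shear.
by case: (j == 0); case: (j == 1); rewrite mulr0 addr0.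
Qed.

(** The first two entries of the last row of shear y z * h, normalised so that
    its third entry is 1 modulo p^a; they are the parameters of the shear that
    represents the coset of shear y z * h. *)
Definition last_row h y z (j : 'I_3) : O :=
  (entry h 2 j + y * entry h 0 j + z * entry h 1 j) / entry h 2 2.

Variables (chi2 chi3 : units O -> units C) (M N : nat).
Hypothesis chi2M : forall u v, chi2 (u * v)%g = (chi2 u * chi2 v)%g.
Hypothesis chi3M : forall u v, chi3 (u * v)%g = (chi3 u * chi3 v)%g.
Hypothesis triv2 : trivial_at chi2 M.
Hypothesis triv3 : trivial_at chi3 N.
Hypotheses (N0 : (0 < N)%N) (MN : (M <= N)%N).
Local Notation chi := (chi_ chi2 chi3 M).

Variables (c1 c2 a : nat).
Hypotheses (Mc1 : (M <= c1)%N) (c1a : (c1 <= a)%N) (Na : (N <= a)%N).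

Section Function.
Variable f : K -> C.
Hypothesis fE : forall h g, par c1 c2 a.+1 h -> f (h * g)%g = chi h * f g.

Lemma chi_shear y z : chi (shear y z) = 1.
Proof.
by apply: (chi1 chi2M chi3M triv2 triv3) => //;
  rewrite entry_shear /= ?mulr0n ?mulr1n ?mul0r ?mulr0 addr0 subrr mpow_0.
Qed.

Lemma shear_absorb y z g : y \in mpow a.+1 -> z \in mpow c2 -> f (shear y z * g)%g = f g.
Proof.
move=> ya zc; rewrite fE ?chi_shear ?mul1r //.
by split; rewrite entry_shear /= ?mulr0n ?mulr1n ?mul0r ?mul1r add0r ?mpow_0.
Qed.

Lemma shear_cong y y' z z' g : y - y' \in mpow a.+1 -> z - z' \in mpow c2 ->
  f (shear y z * g)%g = f (shear y' z' * g)%g.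
Proof.
by move=> dy dz; rewrite -{1}[y](subrK y') -{1}[z](subrK z') -shearD -mulgA; apply: shear_absorb.
Qed.

(** The decomposition shear y z * h = c * shear y' z' with c in C_c; the
    errors in the lower entries of c are products of two elements that are small
    already, and chi c = chi h because c and h have close diagonals. *)
Lemma shear_move e h g y z : (N <= e)%N -> (e <= a)%N -> (c2 <= e + a)%N ->
  entry h 1 0 \in mpow c1 -> entry h 2 1 \in mpow e -> entry h 2 0 \in mpow a ->
  y \in mpow a -> z \in mpow a ->
  f (shear y z * h * g)%g = chi h *
    f (shear (last_row h y z 0%R) (last_row h y z 1%R) * g)%g.
Proof.
move=> Ne ea ce h10 h21 h20 ya za.
have u2 : entry h 2 2 \is a GRing.unit by apply: unit22; mpow_solve.
have u1 : (0 < M)%N -> entry h 1 1 \is a GRing.unit.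
  move=> M0; have [] : entry h 0 0 \is a GRing.unit /\ entry h 1 1 \is a GRing.unit.
    by apply: unit_diag; mpow_solve.
  by [].
set y' := last_row _ _ _ 0; set z' := last_row _ _ _ 1.
have y'E : y' * entry h 2 2 = entry h 2 0 + y * entry h 0 0 + z * entry h 1 0 by rewrite [LHS]divrK.
have z'E : z' * entry h 2 2 = entry h 2 1 + y * entry h 0 1 + z * entry h 1 1 by rewrite [LHS]divrK.
have y'a : y' \in mpow a by rewrite -(unit_mpowMr _ _ u2) y'E; mpow_solve.
have z'e : z' \in mpow e by rewrite -(unit_mpowMr _ _ u2) z'E; mpow_solve.
clearbody y' z'; pose c := (shear y z * h * shear (- y') (- z'))%g.
have cE i j : entry c i j = entry h i j + (i == 2)%:R * (y * entry h 0 j + z * entry h 1 j)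
    - (entry h i 2 + (i == 2)%:R * (y * entry h 0 2 + z * entry h 1 2)) *
      (if j == 0 then y' else if j == 1 then z' else 0).
  rewrite /c !entryM !entry_shear.
  by move: i j; do 2![elim/ord3_ind]; rewrite /= ?mulr0n ?mulr1n; ring.
have -> : (shear y z * h * g)%g = (c * (shear y' z' * g))%g.
  by rewrite /c -!mulgA [(shear (- y') _ * _)%g]mulgA shearD !addNr shear0 mul1g.
have c20 : entry c 2 0 \in mpow a.+1.
  rewrite cE /= !mulr1n !mul1r.
  have -> : entry h 2 0 + (y * entry h 0 0 + z * entry h 1 0) -
      (entry h 2 2 + (y * entry h 0 2 + z * entry h 1 2)) * y' =
      (entry h 2 0 + y * entry h 0 0 + z * entry h 1 0 - y' * entry h 2 2)
      - (y * y' * entry h 0 2 + z * y' * entry h 1 2) by ring.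
  by rewrite -y'E subrr add0r; mpow_solve.
have c21 : entry c 2 1 \in mpow c2.
  rewrite cE /= !mulr1n !mul1r.
  have -> : entry h 2 1 + (y * entry h 0 1 + z * entry h 1 1) -
      (entry h 2 2 + (y * entry h 0 2 + z * entry h 1 2)) * z' =
      (entry h 2 1 + y * entry h 0 1 + z * entry h 1 1 - z' * entry h 2 2)
      - (y * z' * entry h 0 2 + z * z' * entry h 1 2) by ring.
  by rewrite -z'E subrr add0r; mpow_solve.
have c10 : entry c 1 0 \in mpow c1 by rewrite cE /= mulr0n !mul0r !addr0; mpow_solve.
rewrite fE; last by split.
congr (_ * _); apply: (chi_cong chi2M chi3M triv2 triv3) => //.
  by rewrite cE /= mulr0n !mul0r !addr0 addrC addKr; mpow_solve.
by rewrite cE /= mulr1n !mul1r mulr0 subr0 addrC addKr; mpow_solve.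
Qed.

Lemma shear_move0 h g y z : (N <= c2)%N -> (0 < c2 <= a)%N ->
  par c1 c2 a h -> y \in mpow a -> z \in mpow a ->
  f (shear y z * h * g)%g = chi h * f (shear (last_row h y z 0%R) 0%R * g)%g.
Proof.
move=> Nc /andP[c20 c2a] [h10 h21 h20] ya za.
have u2 : entry h 2 2 \is a GRing.unit by apply: unit22; mpow_solve.
rewrite (shear_move _ (e := c2)) //; last by rewrite leq_addr.
congr (_ * _); apply: shear_cong; first by rewrite subrr mpow_0.
by rewrite subr0 unit_mpowMr ?unitrV //; mpow_solve.
Qed.

Variables (theta : O -> C) (s0 sa : seq O).
Hypothesis thetaP : level_character a theta.
Hypotheses (s0P : transversal 0 s0) (saP : transversal a sa).
Hypothesis a0 : (0 < a)%N.

(** An affine substitution multiplies the Fourier coefficient at theta by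
    theta of the translation part; the slope has to be 1 modulo p for it to
    fix the character. *)
Lemma sum_twist (phi : O -> C) (w u : O) : periodic a phi ->
  w \in mpow a -> u - 1 \in mpow 1 ->
  \sum_(y <- sa) theta (- y) * phi (w + y * u) =
  theta w * \sum_(y <- sa) theta (- y) * phi y.
Proof.
move=> per wa u1; have [_ sa_a _ _] := saP.
have uu : u \is a GRing.unit by apply: unit_cong u1 (unitr1 _).
pose Phi y := theta w * (theta (- y) * phi y).
have Pper : periodic a Phi.
  move=> x y xa ya xy; rewrite /Phi (per x y) //; congr (_ * (_ * _)).
  apply: (theta_cong thetaP); first by rewrite rpredN.
  by rewrite opprK addrC -opprB rpredN.
rewrite mulr_sumr -[RHS](sum_reindex (sigma := fun y => w + y * u) saP Pper).
- apply: eq_big_seq => y /sa_a ya; rewrite /Phi mulrA -(thetaD thetaP) ?rpredN ?rpredD ?mpowMr //.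
  congr (_ * _); apply: (theta_cong thetaP); first by rewrite opprD addNKr rpredN mpowMr.
  have -> : - y - (w + - (w + y * u)) = y * (u - 1) by ring.
  by rewrite (@mpowM_le _ _ a 1) // addn1.
- by move=> y ya; rewrite rpredD // mpowMr.
- move=> x y xa ya; rewrite opprD addrACA subrr add0r -mulrBl.
  by rewrite unit_mpowMr.
Qed.

Lemma shear_periodic z g : periodic a (fun y => f (shear y z * g)%g).
Proof. by move=> x y xa ya xy; apply: shear_cong; rewrite ?subrr ?mpow_0. Qed.

(** The Fourier coefficient at theta along the shears of column 0 is
    equivariant under the stabilizer: moving h past the shears is an affine
    substitution in the parameter, to which [sum_twist] applies. *)
Lemma functional_col0_equiv h g : (N <= c2)%N -> (0 < c2 <= a)%N -> stab c1 c2 a h ->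
  \sum_(y <- sa) theta (- y) * f (shear y 0%R * h * g)%g =
  stab_char chi2 chi3 M theta h * \sum_(y <- sa) theta (- y) * f (shear y 0%R * g)%g.
Proof.
move=> Nc c2a' [ph d]; have [_ sa_a _ _] := saP.
have [h10 h21 h20] := ph.
have u2 : entry h 2 2 \is a GRing.unit by case/andP: c2a' => *; apply: unit22; mpow_solve.
rewrite (eq_big_seq (fun y => chi h * (theta (- y) *
    f (shear (entry h 2 0 / entry h 2 2 + y * (entry h 0 0 / entry h 2 2))%R 0%R * g)%g))).
  rewrite -mulr_sumr (sum_twist (shear_periodic 0 g)) ?mulrA //; first by rewrite mpowMr.
  by rewrite -(divrr u2) -mulrBl mpowMr.
move=> y /sa_a ya /=; rewrite shear_move0 ?mpow_0 //.
by rewrite mulrCA /last_row mul0r addr0 mulrDl -[y * _ / _]mulrA.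
Qed.

(** When c1 = 0 the group generated by C_c and the shears acts on both columns,
    and the coefficient at the character (y, z) |-> theta y of the plane of
    shears is the equivariant one. *)
Lemma functional_equiv h g : c1 = 0%N -> c2 = a.+1 -> stab 1 a a h ->
  \sum_(z <- sa) \sum_(y <- sa) theta (- y) * f (shear y z * h * g)%g =
  stab_char chi2 chi3 M theta h *
    \sum_(z <- sa) \sum_(y <- sa) theta (- y) * f (shear y z * g)%g.
Proof.
move=> c1E c2E [[h10 h21 h20] d]; have [_ sa_a _ _] := saP.
have u2 : entry h 2 2 \is a GRing.unit by apply: unit22; mpow_solve.
have [_ u1] : entry h 0 0 \is a GRing.unit /\ entry h 1 1 \is a GRing.unit.
  by apply: unit_diag; mpow_solve.
have perz y : periodic a (fun z => f (shear y z * g)%g).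
  by move=> x z xa za xz; apply: shear_cong; rewrite ?subrr ?mpow_0 ?c2E.
have E y z : y \in mpow a -> z \in mpow a -> f (shear y z * h * g)%g = chi h *
    f (shear (entry h 2 0 / entry h 2 2 + y * (entry h 0 0 / entry h 2 2))%R
      ((entry h 2 1 + y * entry h 0 1) / entry h 2 2 + z * (entry h 1 1 / entry h 2 2))%R * g)%g.
  move=> ya za; rewrite (shear_move (e := a)) ?c1E ?c2E //; try (nat_solve || exact: int_valP).
  congr (_ * _); apply: shear_cong; rewrite /last_row.
    have -> : (entry h 2 0 + y * entry h 0 0 + z * entry h 1 0) / entry h 2 2 -
        (entry h 2 0 / entry h 2 2 + y * (entry h 0 0 / entry h 2 2)) =
        z * entry h 1 0 / entry h 2 2 by ring.
    by rewrite mpowMr //; mpow_solve.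
  by rewrite !mulrDl -!mulrA subrr mpow_0.
have E2 y : y \in mpow a -> \sum_(z <- sa) theta (- y) * f (shear y z * h * g)%g =
    chi h * (theta (- y) * \sum_(z <- sa)
      f (shear (entry h 2 0 / entry h 2 2 + y * (entry h 0 0 / entry h 2 2))%R z * g)%g).
  move=> ya; rewrite -mulr_sumr mulrCA; congr (_ * _).
  set y' := (_ + _)%R.
  rewrite -(@sum_reindex _ _ a sa _ (fun z => (entry h 2 1 + y * entry h 0 1) / entry h 2 2
    + z * (entry h 1 1 / entry h 2 2)) saP (perz y')).
  - by rewrite mulr_sumr; apply: eq_big_seq => z /sa_a za; rewrite E.
  - by move=> z za; rewrite rpredD ?mpowMr // rpredD // mpowMr.
  - move=> x z xa za; rewrite opprD addrACA subrr add0r -mulrBl.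
    by rewrite unit_mpowMr // unitrM unitrV u1.
rewrite exchange_big [in RHS]exchange_big /=.
rewrite (eq_big_seq _ (fun y ys => E2 y (sa_a y ys))) -mulr_sumr.
rewrite (sum_twist (phi := fun y => \sum_(z <- sa) f (shear y z * g)%g)).
- rewrite mulrA; congr (_ * _); apply: eq_bigr => y _; exact: mulr_sumr.
- move=> x y xa ya xy; apply: eq_bigr => z _.
  by apply: shear_cong; rewrite ?subrr ?mpow_0.
- by rewrite mpowMr.
- by rewrite -(divrr u2) -mulrBl mpowMr.
Qed.

Hypothesis c2a : (c2 <= a.+1)%N.

(** Matrices of the upper left 2 x 2 block normalise the group of shears. *)
Lemma shear_elem (i j : 'I_3) t y z g : 1 + t *+ (i == j) \is a GRing.unit ->
  i != 2 -> j != 2 -> t *+ ((1 == i) && (0 == j)) \in mpow c1 ->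
  t *+ ((1 == i) && (1 == j)) \in mpow M -> y \in mpow a -> z \in mpow a ->
  f (shear y z * elem i j t * g)%g =
  f (shear (y + (if i == 0 then y else z) * t *+ (j == 0))%R
           (z + (if i == 0 then y else z) * t *+ (j == 1))%R * g)%g.
Proof.
move=> u i2 j2 t10 t11 ya za; rewrite (shear_move (e := a)) //.
- have -> : chi (elem i j t) = 1.
    apply: (chi1 chi2M chi3M triv2 triv3) => //.
      by rewrite entry_elem // addrC addKr; move: t11.
    by rewrite entry_elem // [2 == i]eq_sym (negPf i2) addr0 subrr mpow_0.
  rewrite mul1r /last_row !entry_elem //.
  move: i j i2 j2 {u t10 t11}; do 2![elim/ord3_ind] => //= _ _;
    rewrite !(mulr0n, mulr1n, addr0, mulr0, mulr1, add0r, divr1) //.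
  + by rewrite mulrDr mulr1.
  + by rewrite addrC.
  + by rewrite mulrDr mulr1.
- nat_solve.
- by rewrite entry_elem // add0r.
- by rewrite entry_elem // [2 == i]eq_sym (negPf i2) addr0 mpow_0.
- by rewrite entry_elem // [2 == i]eq_sym (negPf i2) addr0 mpow_0.
Qed.

(** The diagonal torus permutes the nontrivial characters of p^a / p^(a+1)
    transitively, so if one Fourier coefficient vanishes at all translates then
    all nontrivial ones do. *)
Lemma kernel_col0 : (forall g, \sum_(y <- sa) theta (- y) * f (shear y 0%R * g)%g = 0) ->
  forall z g, z \in mpow a -> f (shear z 0%R * g)%g = f g.
Proof.
move=> ker z g za; have [_ sa_a _ _] := saP.
rewrite -[in RHS](mul1g g) -shear0.
apply: (fourier_const thetaP s0P saP (shear_periodic 0 g)) => // t {}z ut {}za.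
have u : 1 + (- t^-1 - 1) *+ (0 == 0 :> 'I_3) \is a GRing.unit.
  by rewrite eqxx mulr1n addrC subrK unitrN unitrV.
rewrite -[RHS](ker (elem 0%R 0%R (- t^-1 - 1)%R * (shear z 0%R * g))%g).
have per : periodic a (fun y => theta (t * y) * f (shear (y + z)%R 0%R * g)%g).
  move=> x y xa ya xy; congr (_ * _).
    by apply: (theta_cong thetaP); rewrite ?mpowMl // -mulrBr mpowMl.
  by apply: shear_cong; rewrite ?subrr ?mpow_0 // opprD addrACA subrr addr0.
rewrite -(sum_reindex (sigma := fun y => y * - t^-1) saP per).
- apply: eq_big_seq => y /sa_a ya /=; congr (_ * _).
    by congr theta; rewrite mulrCA mulrN divrr // mulrN1.
  rewrite mulgA shear_elem ?mpow_0 //= mulr0n mulr1n addr0.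
  rewrite mulgA shearD; congr (f (shear _ _ * g)%g); ring.
- by move=> y ya; rewrite mpowMr.
- by move=> x y xa ya; rewrite -mulrBl unit_mpowMr // unitrN unitrV.
Qed.

(** For c1 = 0 the block of the first two coordinates acts on the characters
    of the plane of shears.  The unipotents 1 + t E_10 move the second coordinate
    of the character (y, z) |-> theta y arbitrarily, so Fourier inversion in z
    reduces the hypothesis to column 0; conjugation by 1 + E_01 then carries the
    invariance over to column 1. *)
Lemma kernel_full : c1 = 0%N -> c2 = a.+1 -> M = 0%N ->
  (forall g, \sum_(z <- sa) \sum_(y <- sa) theta (- y) * f (shear y z * g)%g = 0) ->
  forall z g, z \in mpow a -> f (shear z 0%R * g)%g = f g /\ f (shear 0%R z * g)%g = f g.
Proof.
move=> c1E c2E ME ker z g za; have [_ sa_a _ _] := saP.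
have perz y x : periodic a (fun z => f (shear y z * x)%g).
  by move=> u v ua va uv; apply: shear_cong; rewrite ?subrr ?mpow_0 ?c2E.
have col0 : forall z g, z \in mpow a -> f (shear z 0%R * g)%g = f g.
  apply: kernel_col0 => {}g.
  pose phi z := \sum_(y <- sa) theta (- y) * f (shear y z * g)%g.
  have per : periodic a phi.
    by move=> u v ua va uv; apply: eq_bigr => y _; rewrite (perz _ _ u v).
  apply: (fourier_zero thetaP s0P saP per) => t.
  rewrite -[RHS](ker (elem 1%R 0%R t * g)%g); apply: eq_big_seq => x /sa_a xa.
  have per' : periodic a (fun y => theta (t * x - y) * f (shear y x * g)%g).
    move=> u v ua va uv; rewrite (shear_periodic x g ua va uv); congr (_ * _).
    apply: (theta_cong thetaP); first by rewrite rpredB ?mpowMl.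
    have -> : t * x - u - (t * x - v) = - (u - v) by ring.
    by rewrite rpredN.
  rewrite mulr_sumr; transitivity (\sum_(y <- sa) theta (t * x - y) * f (shear y x * g)%g).
    apply: eq_big_seq => y /sa_a ya.
    by rewrite mulrA (thetaD thetaP) ?mpowMl ?rpredN.
  rewrite -(sum_reindex (sigma := fun y => y + x * t) saP per').
  - apply: eq_big_seq => y /sa_a ya; congr (_ * _).
      by congr theta; ring.
    rewrite mulgA shear_elem ?c1E ?ME ?mpow_0 //= ?mulr0n ?addr0 ?unitr1 //;
      last exact: int_valP.
  - by move=> y ya; rewrite rpredD // mpowMr.
  - by move=> u v ua va; rewrite opprD addrACA subrr addr0.
split; first exact: col0.
have E : f (elem 0%R 1%R 1%R * g)%g = f g.
  have := @shear_elem 0 1 1 0 0 g.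
  rewrite /= !mulr0n !mulr1n !mul0r !addr0 shear0 !mul1g; apply=> //.
  - by rewrite unitr1.
  - exact: mpow_0.
  - exact: mpow_0.
  - exact: mpow_0.
  - exact: mpow_0.
rewrite -[RHS]E -(col0 z (elem 0%R 1%R 1%R * g)%g za) [in RHS]mulgA.
rewrite shear_elem ?mpow_0 //= ?mulr0n ?addr0 ?unitr1 //.
have -> : shear z (0 + z * 1 *+ 1) = (shear z 0 * shear 0 z)%g.
  by rewrite shearD mulr1n mulr1 addr0.
by rewrite -mulgA col0.
Qed.

Lemma equivariant_col0 h g : (N <= c2)%N -> (0 < c2 <= a)%N ->
  (forall z g, z \in mpow a -> f (shear z 0%R * g)%g = f g) ->
  par c1 c2 a h -> f (h * g)%g = chi h * f g.
Proof.
move=> Nc c2b inv ph; have [h10 h21 h20] := ph.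
have u2 : entry h 2 2 \is a GRing.unit by case/andP: c2b => *; apply: unit22; mpow_solve.
have := shear_move0 g Nc c2b ph (mpow_0 k a) (mpow_0 k a).
rewrite shear0 mul1g => ->; rewrite inv //.
by rewrite /last_row !mul0r !addr0 mpowMr.
Qed.

Lemma equivariant_full h g : c1 = 0%N -> c2 = a.+1 ->
  (forall z g, z \in mpow a -> f (shear z 0%R * g)%g = f g /\ f (shear 0%R z * g)%g = f g) ->
  par 0 a a h -> f (h * g)%g = chi h * f g.
Proof.
move=> c1E c2E inv [h10 h21 h20].
have u2 : entry h 2 2 \is a GRing.unit by apply: unit22; mpow_solve.
have la (j : 'I_3) : entry h 2 j \in mpow a -> last_row h 0 0 j \in mpow a.
  by move=> hj; rewrite /last_row !mul0r !addr0 mpowMr.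
have := @shear_move a h g 0 0; rewrite shear0 mul1g => ->;
  rewrite ?c1E ?mpow_0 //; last by nat_solve.
set y := last_row _ _ _ _; set z := last_row _ _ _ _.
have -> : shear y z = (shear y 0 * shear 0 z)%g by rewrite shearD addr0 add0r.
by rewrite -mulgA (inv _ _ (la 0 h20)).1 (inv _ _ (la 1 h21)).2.
Qed.

Lemma sum_thetaN : \sum_(y <- sa) theta (- y) = 0.
Proof.
rewrite -[RHS](sum_theta thetaP saP).
apply: (sum_reindex (sigma := -%R) saP (theta_periodic thetaP)).
  by move=> y ya; rewrite rpredN.
by move=> x y xa ya; rewrite opprK addrC -opprB rpredN.
Qed.

End Function.
End Shears.

(** * Intertwining at the level of the conductor *)

Section ConductorLevel.
Variables (R : realType) (k : dvFieldType).
Local Notation C := R[i].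
Local Notation O := (integers k).
Local Notation K := (GL3 k).
Variables (chi2 chi3 : units O -> units C) (N : nat).
Hypothesis chi3M : forall u v, chi3 (u * v)%g = (chi3 u * chi3 v)%g.
Hypothesis cond3 : is_cond chi3 N.
Local Notation chi := (chi_ chi2 chi3 0).

(** Let v be the last row of g, and c < N the least valuation of its first two
    entries, attained at the coordinate j.  The perturbation h = 1 + t e_j v fixes the
    last coordinate row and scales v by u = 1 + t v_j, so its conjugate by g
    scales the last coordinate row by u.  As c is less than the conductor, u can
    be a unit of 1 + p^c with chi3 u <> 1. *)
Lemma conductor_no_intertwiner (g : K) : ~ par 0 N N g -> exists b h h',
  [/\ par 0 N N b, par 0 N N h, par 0 N N h', (b * g * h = h' * (b * g))%g & chi h != chi h'].
Proof.
move=> ng; have [triv minN] := cond3.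
have [c [j [cN j2 row2 gj]]] : exists c (j : 'I_3), [/\ (c < N)%N, j != 2,
    forall i, i != 2 -> entry g 2 i \in mpow c & entry g 2 j \notin mpow c.+1].
  pose P c := (entry g 2 0 \notin mpow c) || (entry g 2 1 \notin mpow c).
  have PN : P N.
    apply: contrapT => /negP; rewrite negb_or !negbK => /andP[g0 g1].
    by apply: ng; split=> //; apply: int_valP.
  have [[|c] Pc cmin] := ex_minnP (ex_intro P N PN).
    by case/orP: Pc => /negP[]; apply: int_valP.
  have row2 i : i != 2 -> entry g 2 i \in mpow c.
    have : ~~ P c by apply/negP => /cmin; rewrite ltnn.
    rewrite negb_or !negbK => /andP[g0 g1]; move: i.
    by elim/ord3_ind.
  have cN := cmin _ PN.
  by case/orP: Pc => Pc; [exists c, 0 | exists c, 1].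
have [u] : exists u, ~ (int_val (units_val u) - 1 \in ppow c%:Z -> chi3 u = 1%g).
  by apply/existsNP => /minN; rewrite leqNgt cN.
move=> /not_implyP[u1 chiu].
have u1' : units_val u - 1 \in mpow c by [].
have [t _ tE] := mpow_div gj (leqnn _) u1'.
pose h : K := rank1 (fun i => t *+ (i == j)) (fun i => entry g 2 i).
have hE x y : entry h x y = (x == y)%:R + t *+ (x == j) * entry g 2 y.
  rewrite entry_rank1 //.
  suff -> : 1 + (entry g 2 0 * (t *+ (0 == j)) + entry g 2 1 * (t *+ (1 == j)) +
      entry g 2 2 * (t *+ (2 == j))) = units_val u by apply: units_valP.
  rewrite -[RHS](subrK 1) -tE addrC; congr (_ + _).
  by move: (j); elim/ord3_ind; rewrite /= ?mulr0n ?mulr1n ?mulr0 ?addr0 ?add0r mulrC.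
pose h' := (g * h * g^-1)%g.
have h'E x y : entry h' x y = (x == y)%:R + t * entry g x j * (2 == y)%:R.
  rewrite -(entry_mulgV g 2 y) -(entry_mulgV g x y) /h' !(entryM, hE).
  by move: (j); elim/ord3_ind; rewrite /= ?mulr0n ?mulr1n; ring.
exists 1%g, h, h'; split.
- exact: par1.
- by split; [exact: int_valP | |];
    rewrite hE [2 == j]eq_sym (negPf j2) mulr0n mul0r addr0 mpow_0.
- by split; [exact: int_valP | |]; rewrite h'E /= mulr0 addr0 mpow_0.
- by rewrite mul1g mulgVK.
have -> : chi h = 1.
  by rewrite /chi_ eqxx mul1r hE [2 == j]eq_sym (negPf j2) mulr0n mul0r addr0 eqxx ev1.
rewrite /chi_ eqxx mul1r h'E !eqxx mulr1 tE addrC subrK ev_unit.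
by apply/eqP => e; apply: chiu; apply: val_inj; rewrite /= -e.
Qed.

End ConductorLevel.

Section Finiteness.
Variables (R : realType) (k : dvFieldType) (p q : nat).
Hypothesis hk : padic_field k p q.
Local Notation C := R[i].
Local Notation O := (integers k).
Local Notation K := (GL3 k).

Lemma orbit_finite (H : set K) (psi : K -> C) (f : Ind H psi) :
  exists s : seq (Ind H psi), forall g, ind_rep H psi g f \in s.
Proof.
have := ind_funP f; rewrite unfold_in => /asboolP[_ [n fn]].
have [s sP] := GL3_cover hk n; exists [seq rtrans g f | g <- s] => g.
have [h hs gh] := sP g; apply/mapP; exists h => //.
apply: val_inj; apply/funext => x /=.
by rewrite -{1}(mulVKg h g) mulgA (fn (x * h)%g) //; apply: (congr_diff gh).1.
Qed.

Lemma cosets_finite n (H : set K) : (forall g, congr_subgroup n g -> H g) ->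
  exists s : seq K, forall g, exists2 h, h \in s & exists2 x, H x & g = (x * h)%g.
Proof.
move=> nH; have [s sP] := GL3_cover hk n; exists s => g.
have [h hs gh] := sP g; exists h => //; exists (g * h^-1)%g; last by rewrite mulgVK.
exact/nH/(congr_diff gh).2.
Qed.

End Finiteness.

(** * The spaces U_c *)

Section Assembly.
Variables (R : realType) (k : dvFieldType) (p q : nat).
Hypothesis hk : padic_field k p q.
Local Notation C := R[i].
Local Notation O := (integers k).
Local Notation K := (GL3 k).
Variables (chi2 chi3 : units O -> units C) (M N : nat).
Hypothesis chi2M : forall u v, chi2 (u * v)%g = (chi2 u * chi2 v)%g.
Hypothesis chi3M : forall u v, chi3 (u * v)%g = (chi3 u * chi3 v)%g.
Hypothesis triv2 : trivial_at chi2 M.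
Hypothesis triv3 : trivial_at chi3 N.
Hypotheses (N0 : (0 < N)%N) (MN : (M <= N)%N).
Local Notation chi := (chi_ chi2 chi3 M).
Local Notation ind_fns c := (ind_pred (C_ c) chi).

Lemma ind_equivariant (a b c : nat) (f : K -> C^o) h g :
  f \in ind_fns (a%:Z, b%:Z, c%:Z) -> par a b c h -> f (h * g)%g = chi h * f g.
Proof. by rewrite unfold_in => /asboolP[fE _] /fE. Qed.

Lemma ind_smaller (a b c a' b' c' : nat) (f : K -> C^o) :
  f \in ind_fns (a%:Z, b%:Z, c%:Z) ->
  (forall h g, par a' b' c' h -> f (h * g)%g = chi h * f g) ->
  f \in ind_fns (a'%:Z, b'%:Z, c'%:Z).
Proof.
rewrite !unfold_in => /asboolP[_ smooth] fE; apply/asboolP.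
by split=> // h g; apply: fE.
Qed.

Section Delta.
Variables a b c : nat.
Hypotheses (ac : (a <= c)%N) (bc : (b <= c)%N) (cab : (c <= a + b)%N).
Hypotheses (Ma : (M <= a)%N) (Nb : (N <= b)%N).

(** The generator of U_c: the function supported on C_c that extends chi. *)
Definition delta (g : K) : C^o := if `[< par a b c g >] then chi g else 0.

Lemma deltaP : delta \in ind_fns (a%:Z, b%:Z, c%:Z).
Proof.
have b0 : (0 < b)%N by lia.
have Nc : (N <= c)%N by lia.
have sub g : par a b c g -> par M N N g by apply: par_le.
rewrite unfold_in; apply/asboolP; split=> [h g ph|].
  rewrite /delta; have -> : `[< par a b c (h * g)%g >] = `[< par a b c g >].
    apply/asboolP/asboolP => pg; last exact: parM.
    by rewrite -(mulKg h g); apply: parM => //; apply: parV.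
  case: asboolP => pg; last by rewrite mulr0.
  by rewrite (chiM chi2M chi3M triv2 triv3) //; apply: sub.
exists c => g h hc.
have ph : par a b c h by apply: congr_par hc.
rewrite /delta; have -> : `[< par a b c (g * h)%g >] = `[< par a b c g >].
  apply/asboolP/asboolP => pg; last exact: parM.
  by rewrite -(mulgK h g); apply: parM => //; apply: parV.
case: asboolP => // pg; rewrite (chiM chi2M chi3M triv2 triv3) //; try exact: sub.
move/congrE: hc => hc; have -> : chi h = 1; last by rewrite mulr1.
apply: (chi1 chi2M chi3M triv2 triv3) => //.
  by apply: (mpow_le _ (hc 1 1)); nat_solve.
by apply: (mpow_le _ (hc 2 2)); nat_solve.
Qed.

Lemma delta1 : delta 1%g = 1.
Proof.
rewrite /delta asboolT; last exact: par1.
by apply: (chi1 chi2M chi3M triv2 triv3) => //; rewrite entry1 subrr mpow_0.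
Qed.

(** A function of U_d takes the same value at 1 and at a shear whose parameter
    is in p^c' but not in p^(c'+1); delta vanishes at the latter. *)
Lemma delta_notin (a' b' c' : nat) : (c' < c)%N ->
  delta \notin ind_fns (a'%:Z, b'%:Z, c'%:Z).
Proof.
move=> cc; apply/negP => dP; have [y yc yn] := mpow_proper k c'.
have ps : par a' b' c' (shear y 0).
  by split; rewrite entry_shear /= ?mulr0n ?mulr1n ?mul0r ?mul1r add0r ?mpow_0.
have := ind_equivariant 1%g dP ps; rewrite mulg1 delta1 mulr1.
rewrite (chi_shear chi2M chi3M triv2 triv3 N0) /delta asboolF.
  by move/eqP; rewrite eq_sym oner_eq0.
case=> _ _; rewrite entry_shear /= mulr1n mul1r add0r => yc'.
by move/negP: yn; apply; apply: mpow_le yc'.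
Qed.
End Delta.

(** When the index set below c has a greatest element d, the sum of the U_d'
    is U_d. *)
Lemma lower_top c d (f : U_ chi2 chi3 M c) :
  (forall d', inTm (M%:Z, N%:Z, N%:Z) d' -> triple_lt d' c -> triple_le d' d) ->
  inTm (M%:Z, N%:Z, N%:Z) d -> triple_lt d c ->
  (f \in lower N (c := c)) <-> (ind_fun f \in ind_fns d).
Proof.
move=> top dT dc; split=> [|fd]; rewrite unfold_in.
  move/asboolP=> [s sP ->]; rewrite big_seq; apply: rpred_sum => h /sP[d' [d'T d'c]].
  exact/U_subset/top.
apply/asboolP; exists [:: ind_fun f]; last by rewrite big_seq1.
by move=> h; rewrite inE => /eqP ->; exists d.
Qed.

Lemma lower_bottom c (f : U_ chi2 chi3 M c) :
  (forall d, inTm (M%:Z, N%:Z, N%:Z) d -> ~~ triple_lt d c) ->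
  (f \in lower N (c := c)) <-> f = 0.
Proof.
move=> bot; split=> [|->]; last exact: rpred0.
rewrite unfold_in => /asboolP[[|h s] sP fE].
  by apply: val_inj; rewrite /= fE big_nil.
by have [d [dT dc _]] := sP h (mem_head _ _); move: (bot d dT); rewrite dc.
Qed.

End Assembly.

(** * Irreducibility *)

Section Irreducibility.
Variables (R : realType) (k : dvFieldType) (p q : nat).
Hypothesis hk : padic_field k p q.
Local Notation C := R[i].
Local Notation O := (integers k).
Local Notation K := (GL3 k).
Variables (chi2 chi3 : units O -> units C) (M N : nat).
Hypothesis chi2M : forall u v, chi2 (u * v)%g = (chi2 u * chi2 v)%g.
Hypothesis chi3M : forall u v, chi3 (u * v)%g = (chi3 u * chi3 v)%g.
Hypothesis triv2 : trivial_at chi2 M.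
Hypothesis triv3 : trivial_at chi3 N.
Hypotheses (N0 : (0 < N)%N) (MN : (M <= N)%N).
Local Notation chi := (chi_ chi2 chi3 M).

(** For m > 0 the greatest index below (m, n, m + n) lowers the last
    coordinate by one, and V_c is induced from the stabilizer in C_(m, n, a). *)
Lemma irreducible_generic m n a : (M <= m)%N -> (N <= n)%N -> (0 < m)%N ->
  a.+1 = (m + n)%N ->
  irreducible (V_rep chi2 chi3 M N (m%:Z, n%:Z, a.+1%:Z)).
Proof.
move=> Mm Nn m0 aE; have n0 : (0 < n)%N by nat_solve.
have [Na ma na a0] : [/\ N <= a, m <= a, n <= a & 0 < a]%N by split; nat_solve.
have n0a : (0 < n <= a)%N by rewrite n0.
have [theta thetaP] := level_character_ex R hk a.
have [s0 s0P] := transversal_ex hk 0; have [sa saP] := transversal_ex hk a.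
have fE (f : U_ chi2 chi3 M (m%:Z, n%:Z, a.+1%:Z)) h g :
    par m n a.+1 h -> f (h * g)%g = chi h * f g.
  exact: ind_equivariant (ind_funP f).
have lowerE (f : U_ chi2 chi3 M (m%:Z, n%:Z, a.+1%:Z)) :
    f \in lower N (c := (m%:Z, n%:Z, a.+1%:Z)) <->
    ind_fun f \in ind_pred (C_ (m%:Z, n%:Z, a%:Z)) chi.
  refine (lower_top _ _ _ _).
  - move=> [[d1 d2] d3]; rewrite /inTm /inT /triple_lt /triple_le !xpair_eqE.
    by lia.
  - by rewrite /inTm /inT /triple_le; lia.
  - by rewrite /triple_lt /triple_le !xpair_eqE; lia.
apply: (@mackey_irreducible _ _ _ _ _ _ (stab m n a) (stab_char chi2 chi3 M theta)
  (fun f : U_ chi2 chi3 M (m%:Z, n%:Z, a.+1%:Z) =>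
    \sum_(y <- sa) theta (- y) * f (shear y 0))).
- exact: pchar_num.
- move=> c f g; rewrite mulr_sumr -big_split; apply: eq_bigr => y _ /=.
  by rewrite mulrDr mulrCA.
- exact: stab1.
- by move=> g h; apply: stabM.
- move=> h f sh.
  have E := functional_col0_equiv chi2M chi3M triv2 triv3 N0 MN Mm ma Na (fE f) thetaP saP a0
    1%g Nn n0a sh.
  transitivity (\sum_(y <- sa) theta (- y) * f (shear y 0 * h * 1)%g).
    by apply: eq_bigr => y _; rewrite mulg1.
  by rewrite E; congr (_ * _); apply: eq_bigr => y _; rewrite mulg1.
- move=> f; rewrite lowerE; split=> [ker|fa g].
    apply: (ind_smaller (ind_funP f)) => h g.
    have inv := kernel_col0 chi2M chi3M triv2 triv3 N0 MN Mm ma Na (fE f) thetaP s0P saP a0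
      (leqW na) ker.
    by apply: (equivariant_col0 chi2M chi3M triv2 triv3 N0 MN Mm ma Na (fE f)); rewrite ?(leqW na).
  transitivity (\sum_(y <- sa) theta (- y) * f g); last first.
    by rewrite -mulr_suml (sum_thetaN thetaP saP) mul0r.
  have [_ sa_a _ _] := saP; apply: eq_big_seq => y /sa_a ya /=; congr (_ * _).
  rewrite (ind_equivariant _ fa) ?(chi_shear chi2M chi3M triv2 triv3) ?mul1r //.
  by split; rewrite entry_shear /= ?mulr0n ?mulr1n ?mul0r ?mul1r add0r ?mpow_0.
- have mna : (a.+1 <= m + n)%N by rewrite aE.
  exists (MkInd (deltaP chi2M chi3M triv2 triv3 N0 MN (leqW ma) (leqW na) mna Mm Nn)).
  by apply/negP => /lowerE; apply/negP/(delta_notin chi2M chi3M triv2 triv3).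
- exact: (orbit_finite hk).
- by apply: (cosets_finite hk) => g; apply: stab_congr.
- exact: (stab_no_intertwiner chi2M chi3M triv2 triv3 N0 m0 aE Mm Nn thetaP).
Qed.

(** For m = 0 and n > N the indices below (0, n, n) have greatest element
    (0, n - 1, n - 1).  The stabilizer of a character of the plane of shears is the
    one attached to (1, n - 1), so the intertwining computation of the case
    m > 0 applies verbatim. *)
Lemma irreducible_maximal a : M = 0%N -> (N <= a)%N ->
  irreducible (V_rep chi2 chi3 M N (0, a.+1%:Z, a.+1%:Z)).
Proof.
move=> M0 Na; have a0 : (0 < a)%N by nat_solve.
have M1 : (M <= 1)%N by rewrite M0.
have Ml : (M <= 0)%N by rewrite M0.
have [theta thetaP] := level_character_ex R hk a.
have [s0 s0P] := transversal_ex hk 0; have [sa saP] := transversal_ex hk a.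
have fE (f : U_ chi2 chi3 M (0, a.+1%:Z, a.+1%:Z)) h g :
    par 0 a.+1 a.+1 h -> f (h * g)%g = chi h * f g.
  exact: ind_equivariant (ind_funP f).
have lowerE (f : U_ chi2 chi3 M (0, a.+1%:Z, a.+1%:Z)) :
    f \in lower N (c := (0, a.+1%:Z, a.+1%:Z)) <->
    ind_fun f \in ind_pred (C_ (0, a%:Z, a%:Z)) chi.
  refine (lower_top _ _ _ _).
  - move=> [[d1 d2] d3]; rewrite /inTm /inT /triple_lt /triple_le !xpair_eqE.
    by lia.
  - by rewrite /inTm /inT /triple_le; lia.
  - by rewrite /triple_lt /triple_le !xpair_eqE; lia.
apply: (@mackey_irreducible _ _ _ _ _ _ (stab 1 a a) (stab_char chi2 chi3 M theta)
  (fun f : U_ chi2 chi3 M (0, a.+1%:Z, a.+1%:Z) =>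
    \sum_(z <- sa) \sum_(y <- sa) theta (- y) * f (shear y z))).
- exact: pchar_num.
- move=> c f g; rewrite mulr_sumr -big_split; apply: eq_bigr => z _ /=.
  rewrite mulr_sumr -big_split; apply: eq_bigr => y _ /=.
  by rewrite mulrDr mulrCA.
- exact: stab1.
- by move=> g h; apply: stabM.
- move=> h f sh.
  have E := functional_equiv chi2M chi3M triv2 triv3 N0 MN Ml (leq0n a) Na (fE f) thetaP saP a0
    1%g erefl erefl sh.
  transitivity (\sum_(z <- sa) \sum_(y <- sa) theta (- y) * f (shear y z * h * 1)%g).
    by apply: eq_bigr => z _; apply: eq_bigr => y _; rewrite mulg1.
  by rewrite E; congr (_ * _); apply: eq_bigr => z _; apply: eq_bigr => y _; rewrite mulg1.
- move=> f; rewrite lowerE; split=> [ker|fa g].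
    apply: (ind_smaller (a := 0) (a' := 0) (ind_funP f)) => h g.
    have inv := kernel_full chi2M chi3M triv2 triv3 N0 MN Ml (leq0n a) Na (fE f) thetaP s0P saP a0
      (leqnn _) erefl erefl M0 ker.
    exact: (equivariant_full chi2M chi3M triv2 triv3 N0 MN Ml (leq0n a) Na (fE f)).
  transitivity (\sum_(z <- sa) \sum_(y <- sa) theta (- y) * f g); last first.
    by rewrite big1 // => z _; rewrite -mulr_suml (sum_thetaN thetaP saP) mul0r.
  have [_ sa_a _ _] := saP; apply: eq_big_seq => z /sa_a za.
  apply: eq_big_seq => y /sa_a ya /=; congr (_ * _).
  rewrite (ind_equivariant (a := 0) _ fa) ?(chi_shear chi2M chi3M triv2 triv3) ?mul1r //.
  by split; rewrite entry_shear /= ?mulr0n ?mulr1n ?mul0r ?mul1r add0r ?mpow_0.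
- exists (MkInd (deltaP (a := 0) chi2M chi3M triv2 triv3 N0 MN
    (leq0n _) (leqnn _) (leqnn _) Ml (leqW Na))).
  by apply/negP => /lowerE; apply/negP/(delta_notin chi2M chi3M triv2 triv3 _ _ _ 0).
- exact: (orbit_finite hk).
- by apply: (cosets_finite hk) => g; apply: stab_congr.
- exact: (stab_no_intertwiner chi2M chi3M triv2 triv3 N0 _ _ M1 Na thetaP).
Qed.

(** For m = 0 and n = N there is nothing below c, and V_c is induced from chi
    itself. *)
Lemma irreducible_conductor : M = 0%N -> is_cond chi3 N ->
  irreducible (V_rep chi2 chi3 M N (0, N%:Z, N%:Z)).
Proof.
move=> M0 cond3; have Ml : (M <= 0)%N by rewrite M0.
have fE (f : U_ chi2 chi3 M (0, N%:Z, N%:Z)) h g :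
    par 0 N N h -> f (h * g)%g = chi h * f g.
  exact: ind_equivariant (ind_funP f).
have lowerE (f : U_ chi2 chi3 M (0, N%:Z, N%:Z)) :
    f \in lower N (c := (0, N%:Z, N%:Z)) <-> f = 0.
  refine (lower_bottom _ _) => [[[d1 d2] d3]].
  by rewrite /inTm /inT /triple_lt /triple_le !xpair_eqE; lia.
apply: (@mackey_irreducible _ _ _ _ _ _ (par 0 N N) chi
  (fun f : U_ chi2 chi3 M (0, N%:Z, N%:Z) => f 1%g)).
- exact: pchar_num.
- by [].
- exact: par1.
- by move=> g h; apply: parM.
- by move=> h f ph; rewrite -fE // mulg1 /= mul1g.
- move=> f; rewrite lowerE; split=> [ker|-> //].
  by apply: val_inj; apply/funext => g; have := ker g; rewrite /= mul1g.
- exists (MkInd (deltaP (a := 0) chi2M chi3M triv2 triv3 N0 MN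
    (leq0n _) (leqnn _) (leqnn _) Ml (leqnn _))).
  apply/negP => /lowerE/(congr1 (fun f : U_ chi2 chi3 M (0, N%:Z, N%:Z) => f 1%g)).
  rewrite /= (delta1 chi2M chi3M triv2 triv3) // => /eqP.
  by rewrite oner_eq0.
- exact: (orbit_finite hk).
- by apply: (cosets_finite hk (n := N)) => g; apply: congr_par.
- by rewrite M0; apply: conductor_no_intertwiner.
Qed.

End Irreducibility.

Lemma res_unitsM (R : realType) (k : dvFieldType) (X : {multiplicative units k -> units R[i]})
  (u v : units (integers k)) : res_units X (u * v)%g = (res_units X u * res_units X v)%g.
Proof. by rewrite /res_units /= -gmulfM; congr (X _); apply: val_inj. Qed.

Theorem theorem4p2 (R : realType) (k : dvFieldType) (p q : nat)
  (hk : padic_field k p q) (hp : (2 < p)%N) (hq : (3 < q)%N)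
  (X2 X3 : {multiplicative units k -> units R[i]})
  (X2_cont : char_continuous X2) (X3_cont : char_continuous X3)
  (M N : nat)
  (hM : is_cond (res_units X2) M) (hN : is_cond (res_units X3) N)
  (hMN : (M <= N)%N) (hN0 : (0 < N)%N)
  (h23 : is_cond (fun u => res_units X2 u / res_units X3 u)%g N)
  (m n : int) (hm : M%:Z <= m) (hn : N%:Z <= n) :
  irreducible (V_rep (res_units X2) (res_units X3) M N (m, n, n + m)).
Proof.
have mul2 := res_unitsM X2; have mul3 := res_unitsM X3.
have [triv2 _] := hM; have [triv3 _] := hN.
case: m n hm hn => [m|m] [n|n] //= Mm Nn; rewrite !lez_nat in Mm Nn.
have [m0|m0] := posnP m.
  move: Mm; rewrite m0 addr0 leqn0 => /eqP M0.
  have [nN|] := eqVneq n N; first by rewrite nN; apply: (irreducible_conductor hk).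
  case: n Nn => [|a] Nn nN; first by move: Nn hN0; rewrite leqn0 => /eqP ->.
  by apply: (irreducible_maximal hk) => //; rewrite -ltnS ltn_neqAle eq_sym nN.
have -> : n%:Z + m%:Z = (m + n).-1.+1%:Z by rewrite prednK ?addn_gt0 ?m0 // PoszD addrC.
by apply: (irreducible_generic hk) => //; rewrite prednK // addn_gt0 m0.
Qed.
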